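(* Work in the Gaussian white noise model described in the context, and let the regression function $f$ satisfy condition $C1(\kappa,L)$ with known constants $\kappa>0$ and $L<\infty$ and with sparsity pattern $J$, and let $s=\operatorname{Card}(J)\in\{1,\dots,d^*\}$. For some real numbers $\tau>0$ and $A>1$, set for $\ell=1,\dots,d^*$ $$m_\ell=\bigl(\ell L(1+\tau)/\kappa\bigr)^{1/2},\qquad \lambda_\ell=\frac{2\sqrt{A\,N(\ell,m_\ell^2/\ell)\,d^*\log(2ed/d^* )}+2Ad^*\log(2ed/d^* )}{n}.$$ If $$4\lambda_s\le \frac{\kappa\tau}{1+\tau},$$ then $\widehat J_n(\mathbf m,\boldsymbol\lambda)$ is consistent and satisfies $$\mathbf P\bigl(\widehat J_n(\mathbf m,\boldsymbol\lambda)\not\supset J\bigr)\le 2(2ed/d^* )^{-d^*(A-1)}\quad\text{and}\quad \mathbf P\bigl(\widehat J_n(\mathbf m,\boldsymbol\lambda)\ne J\bigr)\le 3(2ed/d^* )^{-d^*(A-1)}.$$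
   Context: Here $e$ is Euler's number, $n\ge1$ and $1\le d^*\le d$ are integers. ''Consistent'' means that $\mathbf P(\widehat J_n(\mathbf m,\boldsymbol\lambda)\neq J)\to0$ as $d\to\infty$ ($A$ being fixed and the stated condition holding along the sequence). Fourier basis: for $\mathbf k\in\mathbb Z^d$, $\varphi_{\mathbf 0}\equiv1$, $\varphi_{\mathbf k}(\mathbf x)=\sqrt2\cos(2\pi\mathbf k\cdot\mathbf x)$ if $\mathbf k\in(\mathbb Z^d)_+$ and $\varphi_{\mathbf k}(\mathbf x)=\sqrt2\sin(2\pi\mathbf k\cdot\mathbf x)$ if $-\mathbf k\in(\mathbb Z^d)_+$, where $(\mathbb Z^d)_+$ is the set of $\mathbf k\in\mathbb Z^d\setminus\{0\}$ whose first nonzero coordinate is positive. For $f\in L^2([0,1]^d)$, $\theta_{\mathbf k}[f]=\int_{[0,1]^d}f\varphi_{\mathbf k}$. Condition $C1(\kappa,L)$: $\sum_{\mathbf k\in\mathbb Z^d}k_j^2\theta_{\mathbf k}[f]^2\le L$ for all $j\in\{1,\dots,d\}$; and for some $J\subset\{1,\dots,d\}$ with $\operatorname{Card}(J)\le d^*$ (the sparsity pattern) there is a function $\bar f:\mathbb R^{\operatorname{Card}(J)}\to\mathbb R$ with $f(\mathbf x)=\bar f(\mathbf x_J)$ for all $\mathbf x$ ($\mathbf x_J$ being the subvector of coordinates with index in $J$), and $Q_j[f]=\sum_{\mathbf k:k_j\neq0}\theta_{\mathbf k}[f]^2\ge\kappa$ for all $j\in J$. Gaussian white noise model: one observes a Gaussian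 process $\{\mathbf Y(\phi):\phi\in L^2([0,1]^d)\}$ with $\mathbf E[\mathbf Y(\phi)]=\int f\phi$ and $\operatorname{Cov}(\mathbf Y(\phi),\mathbf Y(\phi'))=\frac1n\int\phi\phi'$. Put $y_{\mathbf k}=\mathbf Y(\varphi_{\mathbf k})$; thus $y_{\mathbf k}=\theta_{\mathbf k}[f]+n^{-1/2}\xi_{\mathbf k}$ with $\xi_{\mathbf k}$ i.i.d. $N(0,1)$. Estimator: let $P^d_\ell$ be the set of subsets of $\{1,\dots,d\}$ with exactly $\ell$ elements. For $m>0$, $I\subset\{1,\dots,d\}$ and $j\in\{1,\dots,d\}$, let $S^j_{m,I}=\{\mathbf k\in\mathbb Z^d:\|\mathbf k\|_2\le m,\ \{j\}\subset\operatorname{supp}(\mathbf k)\subset I\}$, where $\operatorname{supp}(\mathbf k)$ is the set of indices of nonzero coordinates, and $\widehat Q^j_{m,I}=\sum_{\mathbf k\in S^j_{m,I}}(y_{\mathbf k}^2-\frac1n)$ (equal to $0$ if the sum is empty). For $\mathbf m=(m_1,\dots,m_{d^*})$ and $\boldsymbol\lambda=(\lambda_1,\dots,\lambda_{d^*})$ with positive entries, $$\widehat J_n(\mathbf m,\boldsymbol\lambda)=\Bigl\{j\in\{1,\dots,d\}:\max_{\ell\le d^*}\lambda_\ell^{-1}\max_{I\in P^d_\ell}\widehat Q^j_{m_\ell,I}\ge1\Bigr\}.$$ For an integer $\ell\ge1$ and $\gamma>0$, $N(\ell,\gamma)=\operatorname{Card}\{\mathbf k\in\mathbb Z^\ell:\|\mathbf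 k\|_2^2\le\gamma\ell,\ k_1\neq0\}$. *)

(* Defs.v *)
From HB Require Import structures.
From mathcomp Require Import all_boot all_order all_algebra finmap.
From mathcomp Require Import all_classical all_reals all_analysis.

Set Implicit Arguments.
Unset Strict Implicit.
Unset Printing Implicit Defensive.

Import Order.TTheory GRing.Theory Num.Theory.
Import numFieldNormedType.Exports.

Local Open Scope classical_set_scope.
Local Open Scope ring_scope.

Section unit_cube.
Context {R : realType}.

Definition lebesgue01 : set (measurableTypeR R) -> \bar R :=
  mrestr (@lebesgue_measure R) (measurable_itv `[(0 : R), 1]).

HB.instance Definition _ := Measure.on lebesgue01.

Lemma lebesgue01_setT : lebesgue01 setT = 1%E.
Proof.
rewrite /lebesgue01 /mrestr setTI; apply: etrans (lebesgue_measure_itv _) _.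
by rewrite /= lte_fin ltr01 oppr0 adde0.
Qed.

HB.instance Definition _ :=
  Measure_isProbability.Build _ _ _ lebesgue01 lebesgue01_setT.

Definition tcons (d : nat) (p : measurableTypeR R * d.-tuple (measurableTypeR R)) :
  d.+1.-tuple (measurableTypeR R) := [tuple of p.1 :: p.2].

Lemma measurable_tcons (d : nat) : measurable_fun setT (@tcons d).
Proof. by apply: measurable_cons; [exact: measurable_fst|exact: measurable_snd]. Qed.

HB.instance Definition _ (d : nat) :=
  isMeasurableFun.Build _ _ _ _ (@tcons d) (@measurable_tcons d).

(* Lebesgue measure on [0,1]^d, seen as a measure on R^d (with the product
   sigma-algebra) carried by the cube: the d-fold product of [lebesgue01].
   Integrals against it are integrals over [0,1]^d. *)
Fixpoint cube (d : nat) : probability (d.-tuple (measurableTypeR R)) R :=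
  match d with
  | 0 => \d_([tuple] : 0.-tuple (measurableTypeR R))
  | d'.+1 => distribution (lebesgue01 \x cube d')%E (@tcons d')
  end.

Lemma cube_box (d : nat) (B : 'I_d -> set (measurableTypeR R)) :
    (forall i, measurable (B i)) ->
  cube d [set x | forall i, B i (tnth x i)] =
  (\prod_(i < d) lebesgue_measure (B i `&` `[0%R, 1%R]%classic))%E.
Proof.
elim: d B => [|d IHd] B mB.
  by rewrite big_ord0 /= diracE mem_set//= => -[].
rewrite big_ord_recl /= /distribution /pushforward.
have -> : @tcons d @^-1` [set x | forall i, B i (tnth x i)] =
    B ord0 `*` [set x | forall i, B (lift ord0 i) (tnth x i)].
  apply/seteqP; split => -[a x] /=.
    move=> Bx; split; first by have := Bx ord0; rewrite tnth0.
    by move=> i; have := Bx (lift ord0 i); rewrite tnthS.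
  move=> [Ba Bx] i; case: (unliftP ord0 i) => [j ->|->].
    by rewrite tnthS.
  by rewrite tnth0.
have mbox : measurable [set x : d.-tuple (measurableTypeR R) |
    forall i, B (lift ord0 i) (tnth x i)].
  rewrite (_ : [set x | _] = \bigcap_(i in [set: 'I_d])
      ((fun x => tnth x i) @^-1` B (lift ord0 i))); last first.
    by apply/seteqP; split => x /= h i; [move=> _|]; exact: h.
  apply: fin_bigcap_measurable; first exact: finite_finset.
  by move=> i _; rewrite -[X in measurable X]setTI; exact: measurable_tnth.
rewrite product_measure1E//; congr (_ * _)%E.
exact: IHd.
Qed.

End unit_cube.

Notation Rvec R d := (d.-tuple (measurableTypeR R)).

Notation freq d := {ffun 'I_d -> int}.

Section fourier.
Context {R : realType} {d : nat}.
Implicit Types (f : Rvec R d -> R) (k : freq d) (j : 'I_d).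

Definition sqnorm2 k : R := \sum_(i < d) ((k i)%:~R : R) ^+ 2.

Definition norm2 k : R := Num.sqrt (sqnorm2 k).

Definition supp k : {set 'I_d} := finset (fun i => k i != 0).

(* the first nonzero coordinate of k exists and is positive *)
Definition freq_pos k : bool :=
  [exists i : 'I_d, (0 < k i) && [forall i' : 'I_d, (i' < i)%N ==> (k i' == 0)]].

Definition phase k (x : Rvec R d) : R :=
  2 * pi * \sum_(i < d) (k i)%:~R * (tnth x i : R).

Definition phi k (x : Rvec R d) : R :=
  if k == 0 then 1
  else if freq_pos k then Num.sqrt 2 * cos (phase k x)
  else Num.sqrt 2 * sin (phase k x).

(* A function on [0,1]^d is represented by any measurable extension to R^d;
   only its values on the cube matter, [cube d] being carried by it. *)
Definition L2cube : {pred Rvec R d -> R} := Lfun (@cube R d) 2%:E.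

Definition theta f k : R := \int[cube d]_x (f x * phi k x).

Definition Qj f j : \bar R := \esum_(k in [set k : freq d | k j != 0]) ((theta f k) ^+ 2)%:E.

(* the subvector x_J, the elements of J being listed in increasing order *)
Definition subvec (J : {set 'I_d}) (x : Rvec R d) : #|J|.-tuple R :=
  [tuple (tnth x (enum_val i) : R) | i < #|J|].

Definition in_cube (x : Rvec R d) : Prop := forall i, 0 <= (tnth x i : R) <= 1.

(* f satisfies C1(kappa, L) with sparsity pattern J, |J| <= dstar. The values
   of f off the unit cube are irrelevant. *)
Record C1 (dstar : nat) (kappa L : R) f (J : {set 'I_d}) : Prop := {
  C1_smooth : forall j,
    (\esum_(k in [set: freq d])
       (((k j)%:~R : R) ^+ 2 * (theta f k) ^+ 2)%:E <= L%:E)%E ;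
  C1_card : (#|J| <= dstar)%N ;
  C1_sparse : exists fbar : #|J|.-tuple R -> R,
    forall x, in_cube x -> f x = fbar (subvec J x) ;
  C1_relevant : forall j, j \in J -> (kappa%:E <= Qj f j)%E
}.

End fourier.

Section white_noise.
Context {disp : measure_display} {T : measurableType disp} {R : realType}.
Variable P : probability T R.

(* Constants are Gaussian. The case s = 0 is singled out because [normal_prob]
   is not a point mass when its deviation parameter is 0. *)
Definition gaussian (X : T -> R) : Prop :=
  exists m s : R, 0 <= s /\
    forall B : set (measurableTypeR R), measurable B ->
      P (X @^-1` B) = if s == 0 then \d_(m : measurableTypeR R) B
                      else normal_prob m s B.

(* Y is the Gaussian white noise observation of f with noise variance 1/n: a
   Gaussian process indexed by L^2([0,1]^d). Nothing is assumed on Y g when g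
   is not square integrable. *)
Record white_noise (d n : nat) (f : Rvec R d -> R)
    (Y : (Rvec R d -> R) -> {RV P >-> R}) : Prop := {
  wn_gaussian : forall (p : nat) (g : 'I_p -> Rvec R d -> R) (c : 'I_p -> R),
    (forall i, g i \in L2cube) ->
    gaussian (fun w => \sum_(i < p) c i * Y (g i) w) ;
  wn_mean : forall g, g \in L2cube ->
    'E_P[Y g]%E = (\int[cube d]_x (f x * g x))%:E ;
  wn_cov : forall g h, g \in L2cube -> h \in L2cube ->
    covariance P (Y g) (Y h) = (n%:R^-1 * \int[cube d]_x (g x * h x))%:E
}.

Section estimator.
Context {d : nat}.
Variables (dstar n : nat) (Y : (Rvec R d -> R) -> {RV P >-> R}).

Definition S_ (m : R) (I : {set 'I_d}) (j : 'I_d) : set (freq d) :=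
  [set k | [/\ norm2 k <= m, j \in supp k & supp k \subset I]].

Definition Qhat (m : R) (I : {set 'I_d}) (j : 'I_d) (w : T) : R :=
  \sum_(k \in S_ m I j) ((Y (phi k) w) ^+ 2 - n%:R^-1).

(* [-oo] is the neutral element of the maximum, so that the inner and outer
   [\big] are plain maxima over nonempty sets when 1 <= dstar <= d. *)
Definition Jhat (m lambda : nat -> R) (w : T) : {set 'I_d} :=
  finset (fun j : 'I_d =>
    (1 <= \big[maxe/-oo]_(1 <= l < dstar.+1)
            (((lambda l)^-1)%:E *
             \big[maxe/-oo]_(I : {set 'I_d} | #|I| == l)
                (Qhat (m l) I j w)%:E))%E).

End estimator.
End white_noise.

Section tuning.
Context {R : realType}.

(* The condition k_1 != 0 is phrased with an existential so that l may be any
   natural number; only l >= 1 is used. *)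
Definition Ncard (l : nat) (gamma : R) : nat :=
  #|` fset_set [set k : freq l | sqnorm2 k <= gamma * l%:R /\
                  exists i : 'I_l, i = 0%N :> nat /\ k i != 0]|%fset.

Definition ratio (d dstar : nat) : R := 2 * expR 1 * d%:R / dstar%:R.

Definition m_ (kappa L tau : R) (l : nat) : R :=
  Num.sqrt (l%:R * L * (1 + tau) / kappa).

Definition lambda_ (A : R) (d dstar n : nat) (kappa L tau : R) (l : nat) : R :=
  let N := (Ncard l (m_ kappa L tau l ^+ 2 / l%:R))%:R in
  (2 * Num.sqrt (A * N * dstar%:R * ln (ratio d dstar))
   + 2 * A * dstar%:R * ln (ratio d dstar)) / n%:R.

Definition rate (A : R) (d dstar : nat) : R :=
  ratio d dstar `^ (- (dstar%:R * (A - 1))).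

Record admissible (A : R) (disp : measure_display) (T : measurableType disp)
    (P : probability T R) (d dstar n : nat) (kappa L tau : R)
    (f : Rvec R d -> R) (J : {set 'I_d})
    (Y : (Rvec R d -> R) -> {RV P >-> R}) : Prop := {
  adm_n : (1 <= n)%N ;
  adm_dstar : (1 <= dstar <= d)%N ;
  adm_kappa : 0 < kappa ;
  adm_tau : 0 < tau ;
  adm_f : f \in L2cube ;
  adm_C1 : C1 dstar kappa L f J ;
  adm_s : (1 <= #|J|)%N ;
  adm_Y : white_noise n f Y ;
  adm_cond :
    4 * lambda_ A d dstar n kappa L tau #|J| <= kappa * tau / (1 + tau)
}.

End tuning.

(* Main.v *)
(* Write D for dstar. The coefficients y_k are independent N(theta_k, 1/n), so the
   statistics of the estimator are centred, possibly noncentral chi-square sums: a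
   product formula for E exp(-t sum y_k^2), and for E exp(t sum y_k^2) when
   theta = 0, yields Chernoff bounds. With x = A D ln(2ed/D), lambda_l dominates
   the threshold (2 sqrt(N x) + 2 x)/n that a pure noise sum exceeds with
   probability at most exp(-x), while a sum whose signal is at least 4 lambda_l
   stays below lambda_l with probability at most exp(-x).
   For j outside J all theta_k with k_j <> 0 vanish, so every statistic is pure
   noise. For j in J the choice I = J captures all of Q_j except the frequencies
   of norm larger than m_s; by the smoothness condition these carry at most
   s L / m_s^2 = kappa/(1+tau), and the remaining signal is at least
   kappa tau/(1+tau).
   A union bound over the pairs (I, j) with j in I and |I| <= D, of which there
   are at most D sum_(l <= D) C(d, l) <= (2ed/D)^D, gives both probability bounds.
   This count is also at least d, whence consistency. *)
Require Import Defs.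
From mathcomp Require Import all_boot all_order all_algebra finmap perm.
From mathcomp Require Import ring lra.
From mathcomp Require Import all_classical all_reals all_analysis.
From mathcomp Require Import measurable_realfun.

Set Implicit Arguments.
Unset Strict Implicit.
Unset Printing Implicit Defensive.

Import Order.TTheory GRing.Theory Num.Theory.
Import numFieldNormedType.Exports.

Local Open Scope classical_set_scope.
Local Open Scope ring_scope.

(** * Integrals against Gaussian laws *)

Section gaussian_integrals.
Context {R : realType}.
Local Notation mu := (@lebesgue_measure R).
Implicit Types (m s a b c t x : R) (G : R -> R).

(** The model only says that each finite linear combination of the [Y g] has some Gaussian law, and
    independence of the y_k is never derived from it. The product formulas come from linearising the
    square: exp(-t y^2) and exp(t y^2) are averages, over an auxiliary standard Gaussian g, of
    cos(sqrt(2t) g y) and exp(sqrt(2t) g y). After exchanging the integrals, the one over the sample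
    space involves a linear combination with one more coefficient, and induction on the list of
    frequencies removes the squares one by one. Only one-dimensional transforms are needed: the
    Laplace transform and, in real form with a phase, the characteristic function. The mean and
    deviation in [gaussian] are unknown parameters, so they must first be identified with the
    moments supplied by [wn_mean] and [wn_cov]. The 2 in 2ed/D pays for the factor D in the number
    of pairs, since D <= 2^D. The indices of J require the single set I = J, and the bounds reached
    are [rate] and [2 * rate]. *)

Lemma ge0_integral_normal_prob m s (G : measurableTypeR R -> R) :
  measurable_fun setT G -> (forall x, 0 <= G x) ->
  (\int[normal_prob m s]_x (G x)%:E = \int[mu]_x (G x * normal_pdf m s x)%:E)%E.
Proof.
move=> mG G0.
have numu := @normal_prob_dominates R m s.
rewrite -(Radon_Nikodym_SigmaFinite.change_of_variables numu)//=; last first.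
  exact/measurable_EFinP.
under [RHS]eq_integral do rewrite EFinM.
have mG' : measurable_fun setT (EFin \o G) by exact/measurable_EFinP.
apply: ae_eq_integral => //.
- apply: emeasurable_funM => //.
  exact: measurable_int (Radon_Nikodym_SigmaFinite.f_integrable numu).
- apply: emeasurable_funM => //; apply/measurable_EFinP.
  exact: measurable_normal_pdf.
(* The Radon-Nikodym derivative and the Gaussian density agree almost everywhere, since both
   integrate to [normal_prob m s E] over every measurable E. *)
- apply: ae_eqe_mul2l => /=; apply: integral_ae_eq => //=.
  + exact: Radon_Nikodym_SigmaFinite.f_integrable.
  + by apply/measurable_EFinP; exact: measurable_normal_pdf.
  + by move=> E _ mE; rewrite -Radon_Nikodym_SigmaFinite.f_integral.
Qed.

Lemma continuous_measurableT G :
  continuous G -> measurable_fun [set: measurableTypeR R] G.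
Proof. exact: continuous_measurable_fun. Qed.

(** Substitution along x -> m + s x. It is used in both directions: to standardise a law, and to
    recognise a tilted or scaled standard density as that of another normal law. *)
Lemma integral_normal_affine m s G : 0 < s ->
  continuous G -> (forall x, 0 <= G x) ->
  (\int[normal_prob m s]_x (G x)%:E =
   \int[normal_prob 0 1]_x (G (m + s * x))%:E)%E.
Proof.
move=> s0 cG G0.
have dF x : is_derive x 1 (fun y : R => m + s * y) s.
  have h := is_deriveD (@is_derive_cst R R^o R^o m x 1)
    (is_deriveZ s (@is_derive_id R R^o x 1)).
  by apply: (is_derive_eq h); rewrite add0r; exact: mulr1.
have F' : derive1 (fun y : R => m + s * y) = cst s.
  by apply/funext => x; rewrite derive1E; exact: (@derive_val _ _ _ _ _ _ _ (dF x)).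
have cF : continuous (fun y : R => m + s * y).
  move=> x; apply: cvgD; first exact: cvg_cst.
  by apply: cvgM; [exact: cvg_cst|exact: cvg_id].
have cGF : continuous (fun y : R => G (m + s * y)).
  by move=> x; apply: continuous_comp; [exact: cF|exact: cG].
have mG := continuous_measurableT cG.
have mGF := continuous_measurableT cGF.
rewrite (ge0_integral_normal_prob _ _ mG G0).
rewrite (ge0_integral_normal_prob _ _ mGF (fun x => G0 _)).
rewrite (@increasing_ge0_integration_by_substitutionT _ (fun y => m + s * y)
   (fun x => G x * normal_pdf m s x)).
- apply: eq_integral => x _; congr EFin.
  rewrite F' !fctE /= -mulrA; congr (_ * _).
  rewrite !normal_pdfE ?gt_eqF// /normal_peak /normal_fun mulrAC.
  congr (_ * expR _).
    rewrite expr1n mul1r -mulrnAr sqrtrM ?sqr_ge0// sqrtr_sqr gtr0_norm//.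
    by rewrite invfM mulrC mulrA divff ?gt_eqF// mul1r.
  have sn0 : s != 0 by rewrite gt_eqF.
  by rewrite subr0 (addrC m) addrK; field.
- by move=> x y xy; rewrite ltrD2l ltr_pM2l.
- by rewrite F' => x; exact: cvg_cst.
- by rewrite F'; exact: is_cvg_cst.
- by rewrite F'; exact: is_cvg_cst.
- by move=> x; have [] := dF x.
- apply/cvgrNyPle => M; near=> x.
  by rewrite -lerBrDl -ler_pdivlMl.
- apply/cvgryPge => M; near=> x.
  by rewrite -lerBlDl -ler_pdivrMl.
- move=> x; apply: cvgM; first exact: cG.
  by apply: continuous_normal_pdf; rewrite gt_eqF.
- by move=> x; rewrite mulr_ge0// normal_pdf_ge0.
Unshelve. all: end_near. Qed.

End gaussian_integrals.

(** * Transforms of the standard Gaussian measure *)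

Section gaussian_transforms.
Context {R : realType}.
Local Notation gam := (normal_prob (0 : R) 1).
Implicit Types (m s a b c t x : R) (G : R -> R).

Lemma continuous_expRM b : continuous (fun x : R => expR (b * x)).
Proof.
move=> x; apply: continuous_comp; last exact: continuous_expR.
by apply: cvgM; [exact: cvg_cst|exact: cvg_id].
Qed.

Lemma continuous_expRMsqr t : continuous (fun x : R => expR (t * x ^+ 2)).
Proof.
move=> x; apply: continuous_comp; last exact: continuous_expR.
by apply: cvgM; [exact: cvg_cst|exact: sqr_continuous].
Qed.

Lemma continuous_affine a b : continuous (fun x : R => a * x + b).
Proof.
move=> x; apply: cvgD; last exact: cvg_cst.
by apply: cvgM; [exact: cvg_cst|exact: cvg_id].
Qed.

(** Completing the square: b x - x^2/2 = b^2/2 - (x - b)^2/2. The 1 in [b + 1 * x] is the deviation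
    in [integral_normal_affine]. *)
Lemma ge0_integral_gauss_tilt b G : continuous G -> (forall x, 0 <= G x) ->
  (\int[gam]_x (expR (b * x) * G x)%:E =
   (expR (b ^+ 2 / 2))%:E * \int[gam]_x (G (b + 1 * x))%:E)%E.
Proof.
move=> cG G0; rewrite -(integral_normal_affine _ ltr01 cG G0).
have mG := continuous_measurableT cG.
have me := continuous_measurableT (@continuous_expRM b).
rewrite (ge0_integral_normal_prob _ _ mG G0).
rewrite (ge0_integral_normal_prob _ _ (measurable_funM me mG)); last first.
  by move=> x; rewrite mulr_ge0 ?expR_ge0.
rewrite -ge0_integralZl//.
- apply: eq_integral => x _; rewrite -EFinM; congr EFin.
  rewrite !normal_pdfE ?oner_eq0// /normal_fun /=.
  set p := normal_peak 1; set e1 := expR (b * x); set e2 := expR (_ / _).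
  set e3 := expR (_ / 2); set e4 := expR (_ / _).
  have h : e1 * e2 = e3 * e4.
    by rewrite -!expRD; congr expR; field.
  transitivity (p * G x * (e1 * e2)); first by ring.
  by rewrite h; ring.
- apply/measurable_EFinP/measurable_funM => //; exact: measurable_normal_pdf.
- by move=> x _; rewrite lee_fin mulr_ge0 ?normal_pdf_ge0.
Qed.

(** The product of exp(-t x^2) with the standard density is s times the density of N(0, s^2), where
    s = (1 + 2t)^(-1/2). Negative t is allowed as long as 1 + 2t > 0, which covers the moment
    generating function of a square. *)
Lemma ge0_integral_gauss_scale t G : 0 < 1 + 2 * t ->
  continuous G -> (forall x, 0 <= G x) ->
  (\int[gam]_x (expR (- t * x ^+ 2) * G x)%:E =
   ((Num.sqrt (1 + 2 * t))^-1)%:E *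
   \int[gam]_x (G (0 + (Num.sqrt (1 + 2 * t))^-1 * x))%:E)%E.
Proof.
move=> t0 cG G0; set s := (Num.sqrt _)^-1.
have s0 : 0 < s by rewrite invr_gt0 sqrtr_gt0.
rewrite -(integral_normal_affine _ s0 cG G0).
have mG := continuous_measurableT cG.
have me := continuous_measurableT (@continuous_expRMsqr (- t)).
rewrite (ge0_integral_normal_prob _ _ mG G0).
rewrite (ge0_integral_normal_prob _ _ (measurable_funM me mG)); last first.
  by move=> x; rewrite mulr_ge0 ?expR_ge0.
rewrite -ge0_integralZl//.
- apply: eq_integral => x _; rewrite -EFinM; congr EFin.
  rewrite !normal_pdfE ?oner_eq0 ?gt_eqF// /normal_fun /=.
  have -> : normal_peak s = s^-1 * normal_peak 1.
    rewrite /normal_peak expr1n mul1r -[in LHS]mulrnAr.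
    by rewrite sqrtrM ?sqr_ge0// sqrtr_sqr gtr0_norm// invfM.
  set p := normal_peak 1; set e1 := expR (- t * x ^+ 2); set e2 := expR (_ / _).
  set e3 := expR (_ / _).
  have h : e1 * e2 = e3.
    rewrite -!expRD; congr expR.
    rewrite /s exprVn sqr_sqrtr ?ltW//; have := t0; rewrite lt0r => /andP[tn0 _].
    by field.
  have sn0 : s != 0 by rewrite gt_eqF.
  transitivity (p * G x * (e1 * e2)); first by ring.
  by rewrite h; field.
- apply/measurable_EFinP/measurable_funM => //; exact: measurable_normal_pdf.
- by move=> x _; rewrite lee_fin mulr_ge0 ?normal_pdf_ge0.
- by rewrite lee_fin ltW.
Qed.

Lemma integral_gauss_cst1 : (\int[gam]_x (1 : R)%:E = 1)%E.
Proof. by rewrite integral_cst//= probability_setT mule1. Qed.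

Lemma integral_gauss_expR b :
  (\int[gam]_x (expR (b * x))%:E = (expR (b ^+ 2 / 2))%:E)%E.
Proof.
have := ge0_integral_gauss_tilt b (fun x => cvg_cst (1 : R)) (fun=> ler01).
rewrite integral_gauss_cst1 mule1 => <-.
by apply: eq_integral => x _; rewrite mulr1.
Qed.

Lemma integral_gauss_expRsqr t : 0 < 1 + 2 * t ->
  (\int[gam]_x (expR (- t * x ^+ 2))%:E = ((Num.sqrt (1 + 2 * t))^-1)%:E)%E.
Proof.
move=> t0.
have := ge0_integral_gauss_scale t0 (fun x => cvg_cst (1 : R)) (fun=> ler01).
rewrite integral_gauss_cst1 mule1 => <-.
by apply: eq_integral => x _; rewrite mulr1.
Qed.

(* Adding 1 to G reduces the bounded case to the nonnegative one. *)
Lemma bounded_integral_transfer (dT dT' : measure_display)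
    (T : measurableType dT) (T' : measurableType dT')
    (P : probability T R) (Q : probability T' R)
    (w : T -> R) (u : T -> R) (v : T' -> R) c :
  measurable_fun setT w -> measurable_fun setT u -> measurable_fun setT v ->
  (forall z, 0 <= w z) ->
  (forall G, continuous G -> (forall x, 0 <= G x) ->
    (\int[P]_z (w z * G (u z))%:E = c%:E * \int[Q]_z (G (v z))%:E)%E) ->
  forall G, continuous G -> (forall x, `|G x| <= 1) ->
    (\int[P]_z (w z * G (u z))%:E = c%:E * \int[Q]_z (G (v z))%:E)%E.
Proof.
move=> mw mu mv w0 H G cG G1.
have mG := continuous_measurableT cG.
have mGu : measurable_fun setT (G \o u) by exact: measurableT_comp.
have mGv : measurable_fun setT (G \o v) by exact: measurableT_comp.
have iw : (\int[P]_x (w x)%:E = c%:E)%E.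
  have := H (fun=> 1) (fun x => cvg_cst (1 : R)) (fun=> ler01).
  rewrite integral_cst//= probability_setT !mule1 => <-.
  by apply: eq_integral => x _; rewrite mulr1.
have intw : P.-integrable setT (EFin \o w).
  apply/integrableP; split; first exact/measurable_EFinP.
  rewrite (eq_integral (EFin \o w)) ?iw ?ltry// => x _ /=.
  by rewrite ger0_norm.
have intwG : P.-integrable setT (EFin \o (fun z => w z * G (u z))).
  apply: (le_integrable measurableT _ _ intw).
    by apply/measurable_EFinP; exact: measurable_funM.
  move=> x _ /=; rewrite lee_fin normrM ger0_norm//.
  by rewrite -[leRHS]mulr1 ler_wpM2l.
have int1 : Q.-integrable setT (EFin \o (fun=> (1 : R))).
  exact: finite_measure_integrable_cst.
have intG : Q.-integrable setT (EFin \o (G \o v)).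
  apply: (le_integrable measurableT _ _ int1); first exact/measurable_EFinP.
  by move=> x _ /=; rewrite lee_fin normr1.
have cG1 : continuous (fun x => G x + 1).
  by move=> x; apply: cvgD; [exact: cG|exact: cvg_cst].
have G10 x : 0 <= G x + 1 by have := G1 x; rewrite ler_norml => /andP[]; lra.
have := H _ cG1 G10.
under eq_integral do rewrite mulrDr mulr1 EFinD.
rewrite integralD//= iw.
under [in X in (_ = X)%E -> _]eq_integral do rewrite EFinD.
rewrite (integralD measurableT intG int1)/=.
have -> : (\int[Q]__ 1 = 1)%E.
  by rewrite integral_cst//= probability_setT mule1.
have /integrable_fin_num -/(_ measurableT)/fineK <- := intG.
have /integrable_fin_num -/(_ measurableT)/fineK <- := intwG.
by rewrite -!EFinD -!EFinM => -[] e; congr EFin; move: e; rewrite /=; lra.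
Qed.

End gaussian_transforms.

(** * Characteristic function of the standard Gaussian, in real form *)

Section gaussian_characteristic.
Context {R : realType}.
Local Notation gam := (normal_prob (0 : R) 1).
Implicit Types (a b c t x : R).

Lemma is_derive_affine c b t : is_derive t 1 (fun y : R => c * y + b) c.
Proof.
have h := is_deriveD (is_deriveZ c (@is_derive_id R R^o t 1))
  (@is_derive_cst R R^o R^o b t 1).
by apply: (is_derive_eq h); rewrite addr0; exact: mulr1.
Qed.

Lemma is_derive_cos_affine c b t :
  is_derive t 1 (fun y : R => cos (c * y + b)) (- c * sin (c * t + b)).
Proof.
have h := @is_derive1_comp R cos (fun y => c * y + b) t _ _
  (is_derive_cos (c * t + b)) (is_derive_affine c b t).
by apply: (is_derive_eq h); rewrite mulNr mulrC mulNr.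
Qed.

Lemma is_derive_sin_affine c b t :
  is_derive t 1 (fun y : R => sin (c * y + b)) (c * cos (c * t + b)).
Proof.
have h := @is_derive1_comp R sin (fun y => c * y + b) t _ _
  (is_derive_sin (c * t + b)) (is_derive_affine c b t).
by apply: (is_derive_eq h); rewrite mulrC.
Qed.

Lemma is_derive_expR_affine c b t :
  is_derive t 1 (fun y : R => expR (c * y + b)) (c * expR (c * t + b)).
Proof.
have h := @is_derive1_comp R expR (fun y => c * y + b) t _ _
  (is_derive_expR (c * t + b)) (is_derive_affine c b t).
by apply: (is_derive_eq h); rewrite mulrC.
Qed.

Lemma is_derive_expR_half_sqr t :
  is_derive t 1 (fun y : R => expR (y ^+ 2 / 2)) (t * expR (t ^+ 2 / 2)).
Proof.
have h1 := is_deriveZ (2^-1) (@is_deriveX R R^o id 2 t 1 1 (@is_derive_id R R^o t 1)).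
have e : (2^-1 : R) \*: (id ^+ 2 : R -> R) = (fun y : R => y ^+ 2 / 2).
  by apply/funext => y; rewrite /= mulrC.
rewrite e in h1.
have h := @is_derive1_comp R expR (fun y => y ^+ 2 / 2) t _ _
  (is_derive_expR (t ^+ 2 / 2)) h1.
apply: (is_derive_eq h); rewrite expr1 -[_ *: 1]/(_ * 1) -[_ *: _]/(_ * _).
by rewrite mulr1; field.
Qed.

(** Domination is asked only within distance 1 of a, because a derivative such as x exp(t x) has no
    majorant uniform in t. *)
Lemma is_derive_under_integral_gauss (f df : R -> R -> R) (G : R -> R) a :
  (forall t, gam.-integrable setT (EFin \o f t)) ->
  (forall t x, is_derive t 1 (f ^~ x) (df t x)) ->
  (forall x, 0 <= G x) -> gam.-integrable setT (EFin \o G) ->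
  (forall t x, a - 1 < t < a + 1 -> `|df t x| <= G x) ->
  is_derive a 1 (fun t => \int[gam]_x f t x) (\int[gam]_x df a x).
Proof.
move=> fi fd G0 Gi Gb.
have Ia : `](a - 1), (a + 1)[%classic a.
  by rewrite /= in_itv/=; apply/andP; split; lra.
have p1 t x : partial1of2 f t x = df t x.
  by rewrite partial1of2E; exact: (@derive_val _ _ _ _ _ _ _ (fd t x)).
have fi' t : `](a - 1), (a + 1)[%classic t ->
  gam.-integrable setT (EFin \o f t) by move=> _; exact: fi.
have fd' t x : `](a - 1), (a + 1)[%classic t -> [set: R] x ->
  derivable (f ^~ x) t 1 by move=> _ _; have [] := fd t x.
have Gb' t x : `](a - 1), (a + 1)[%classic t -> [set: R] x ->
  `|partial1of2 f t x| <= G x.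
  by move=> /=; rewrite in_itv/= p1 => ta _; exact: Gb.
apply: DeriveDef.
  exact: (derivable_under_integral measurableT Ia fi' fd' G0 Gi Gb').
rewrite -derive1E.
rewrite (differentiation_under_integral measurableT Ia fi' fd' G0 Gi Gb').
by apply: eq_Rintegral => x _; rewrite p1.
Qed.

(** One integrable majorant serves both differentiations under the integral: in the tilt near 0 and,
    with b = 0, in the frequency. *)
Lemma norm_expRM_le b x : -1 <= b <= 1 ->
  `|x| * expR (b * x) <= expR (2 * x) + expR (- 2 * x).
Proof.
move=> /andP[b1 b2].
apply: (@le_trans _ _ (expR (2 * `|x|))); last first.
  have [x0|x0] := ger0P x; first by rewrite ler_wpDr ?expR_ge0.
  by rewrite mulrN -mulNr ler_wpDl ?expR_ge0.
rewrite mulr_natl mulr2n expRD ler_pM ?expR_ge0//.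
  by apply: le_trans (expR_ge1Dx _); rewrite lerDr.
rewrite ler_expR; apply: le_trans (ler_norm _) _.
by rewrite normrM ler_piMl// ler_norml b1.
Qed.

Lemma integrable_gauss_expR b : gam.-integrable setT (EFin \o (fun x => expR (b * x))).
Proof.
apply/integrableP; split.
  apply/measurable_EFinP.
  exact: (continuous_measurableT (@continuous_expRM R b)).
under eq_integral do rewrite /= ger0_norm ?expR_ge0//.
by rewrite integral_gauss_expR ltry.
Qed.

Lemma integrable_gauss_expR2 :
  gam.-integrable setT (EFin \o (fun x => expR (2 * x) + expR (- 2 * x))).
Proof.
rewrite (_ : EFin \o _ = (EFin \o (fun x => expR (2 * x))) \+
  (EFin \o (fun x => expR (- 2 * x))))%E//.
by apply: integrableD => //; exact: integrable_gauss_expR.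
Qed.

Lemma continuous_cos_affine a b : continuous (fun x : R => cos (a * x + b)).
Proof.
move=> x; apply: continuous_comp; last exact: continuous_cos.
exact: continuous_affine.
Qed.

Lemma integrable_gauss_expR_cos c a b :
  gam.-integrable setT (EFin \o (fun x => expR (c * x) * cos (a * x + b))).
Proof.
apply: (le_integrable measurableT _ _ (integrable_gauss_expR c)).
  apply/measurable_EFinP/measurable_funM.
    exact: (continuous_measurableT (@continuous_expRM R c)).
  exact: (continuous_measurableT (@continuous_cos_affine a b)).
move=> x _ /=; rewrite lee_fin normrM -[leRHS]mulr1 ler_wpM2l//.
exact: cos_max.
Qed.

(** Keeping the phase b closes the family under differentiation: a sine is the cosine with phase b -
    pi/2. *)
Let C a b := \int[gam]_x cos (a * x + b).

Let integrable_cos a b : gam.-integrable setT (EFin \o (fun x => cos (a * x + b))).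
Proof.
have := integrable_gauss_expR_cos 0 a b.
by apply: eq_integrable => // x _ /=; rewrite mul0r expR0 mul1r.
Qed.

Let CD a b h : C a (b + h) = cos h * C a b - sin h * C a (b - pi / 2).
Proof.
rewrite /C -!RintegralZl// -RintegralB//.
- apply: eq_Rintegral => x _; rewrite addrA cosD addrA cosBpihalf.
  by rewrite mulrC [X in _ - X]mulrC.
- rewrite (_ : EFin \o _ =
    (fun x => (cos h)%:E * (EFin \o (fun x => cos (a * x + b))) x)%E)//.
  exact: integrableZl.
- rewrite (_ : EFin \o _ =
    (fun x => (sin h)%:E * (EFin \o (fun x => cos (a * x + (b - pi / 2)))) x)%E)//.
  exact: integrableZl.
Qed.

Let tilt a b c : \int[gam]_x (expR (c * x) * cos (a * x + b)) =
  expR (c ^+ 2 / 2) * C a (b + a * c).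
Proof.
have H := @bounded_integral_transfer R _ _ _ _ gam gam (fun x => expR (c * x)) id
  (fun x => c + 1 * x) (expR (c ^+ 2 / 2))
  (continuous_measurableT (@continuous_expRM R c)) (@measurable_id _ _ _)
  (continuous_measurableT _) (fun=> expR_ge0 _) (@ge0_integral_gauss_tilt R c)
  _ (@continuous_cos_affine a b) (fun=> cos_max _).
have e : (\int[gam]_z (cos (a * (c + 1 * z) + b))%:E =
    \int[gam]_z (cos (a * z + (b + a * c)))%:E)%E.
  by apply: eq_integral => x _; congr (cos _)%:E; ring.
rewrite /Rintegral H; last first.
  move=> x; apply: cvgD; first exact: cvg_cst.
  by apply: cvgM; [exact: cvg_cst|exact: cvg_id].
rewrite e fineM//.
exact: (integrable_fin_num measurableT (integrable_cos a (b + a * c))).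
Qed.

(** Stein's identity E[x g(x)] = E[g'(x)] for g(x) = cos(a x + b), obtained by differentiating
    [tilt] in c at 0; [CD] makes the dependence of its right-hand side on c explicit. *)
Let integral_id_cos a b :
  \int[gam]_x (x * cos (a * x + b)) = - a * C a (b - pi / 2).
Proof.
have h1 : is_derive (0 : R) (1 : R) (fun t => \int[gam]_x (expR (t * x) * cos (a * x + b)))
    (\int[gam]_x (x * expR (0 * x) * cos (a * x + b))).
  apply: (@is_derive_under_integral_gauss (fun t x => expR (t * x) * cos (a * x + b))
    (fun t x => x * expR (t * x) * cos (a * x + b))
    (fun x => expR (2 * x) + expR (- 2 * x))).
  - by move=> t; exact: integrable_gauss_expR_cos.
  - move=> t x.
    have h := is_deriveM (is_derive_expR_affine x 0 t)
      (@is_derive_cst R R^o R^o (cos (a * x + b)) t 1).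
    rewrite (_ : (fun _ => _) = (fun y : R => expR (x * y + 0)) * cst (cos (a * x + b))).
      by apply: (is_derive_eq h); rewrite scaler0 add0r addr0 mulrC (mulrC t)//;
        exact: mulrC.
    by apply/funext => y; rewrite !fctE/= addr0 [y * x]mulrC.
  - by move=> x; rewrite addr_ge0 ?expR_ge0.
  - exact: integrable_gauss_expR2.
  - move=> t x /andP[t1 t2]; have tb : -1 <= t <= 1 by apply/andP; split; lra.
    apply: le_trans (norm_expRM_le x tb).
    rewrite normrM normrM (ger0_norm (expR_ge0 _)) -[leRHS]mulr1 ler_wpM2l//.
    exact: cos_max.
rewrite (_ : (fun t => _) = (fun t => expR (t ^+ 2 / 2) *
   (cos (a * t + 0) * C a b - sin (a * t + 0) * C a (b - pi / 2)))) in h1; last first.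
  by apply/funext => t; rewrite tilt CD addr0.
have h2 := is_deriveM (is_derive_expR_half_sqr 0) (is_deriveB
  (is_deriveM (is_derive_cos_affine a 0 0) (@is_derive_cst R R^o R^o (C a b) 0 1))
  (is_deriveM (is_derive_sin_affine a 0 0)
    (@is_derive_cst R R^o R^o (C a (b - pi / 2)) 0 1))).
have := @derive_val _ _ _ _ _ _ _ h2.
rewrite (@derive_val _ _ _ _ _ _ _ h1) => h3.
transitivity (\int[gam]_x (x * expR (0 * x) * cos (a * x + b))).
  by apply: eq_Rintegral => x _; rewrite mul0r expR0 mulr1.
rewrite h3 /GRing.scale/= !(mulr0, mul0r, addr0, add0r, oppr0) sin0 cos0.
rewrite expr0n/= mul0r expR0; ring.
Qed.

(** Differentiation gives - E[x sin(a x + b)], which Stein's identity at phase b - pi/2 turns into -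
    a C. This is the differential equation solved by exp(-a^2/2) cos b. *)
Let dC a b : is_derive a 1 (fun t => C t b) (- a * C a b).
Proof.
have h1 : is_derive a 1 (fun t => C t b) (\int[gam]_x (- x * sin (x * a + b))).
  apply: (@is_derive_under_integral_gauss (fun t x => cos (t * x + b))
    (fun t x => - x * sin (x * t + b)) (fun x => expR (2 * x) + expR (- 2 * x))).
  - by [].
  - move=> t x; rewrite (_ : (fun _ => _) = (fun y => cos (x * y + b))).
      exact: is_derive_cos_affine.
    by apply/funext => y; rewrite mulrC.
  - by move=> x; rewrite addr_ge0 ?expR_ge0.
  - exact: integrable_gauss_expR2.
  - move=> t x _; apply: (@le_trans _ _ (`|x| * expR (0 * x))); last first.
      by apply: norm_expRM_le; apply/andP; split; lra.
    rewrite mul0r expR0 normrM normrN ler_wpM2l//; exact: sin_max.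
apply: (is_derive_eq h1).
have := integral_id_cos a (b - pi / 2).
have -> : b - pi / 2 - pi / 2 = b - pi by field.
have -> : C a (b - pi) = - C a b.
  rewrite CD cosN cospi sinN sinpi; ring.
rewrite mulrNN => h.
transitivity (- \int[gam]_x (x * cos (a * x + (b - pi / 2)))); last by rewrite h mulNr.
rewrite -[RHS]mulN1r -RintegralZl//.
  apply: eq_Rintegral => x _.
  by rewrite addrA cosBpihalf (mulrC x a) mulNr mulN1r.
apply: (le_integrable measurableT _ _ integrable_gauss_expR2).
  apply/measurable_EFinP/measurable_funM; first exact: measurable_id.
  exact: (continuous_measurableT (@continuous_cos_affine a (b - pi / 2))).
move=> x _ /=; rewrite lee_fin [leRHS]ger0_norm ?addr_ge0 ?expR_ge0//.
apply: (@le_trans _ _ (`|x| * expR (0 * x))).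
  by rewrite mul0r expR0 normrM ler_wpM2l//; exact: cos_max.
by apply: norm_expRM_le; apply/andP; split; lra.
Qed.

Lemma integral_gauss_cos a b :
  (\int[gam]_x (cos (a * x + b))%:E = (expR (- a ^+ 2 / 2) * cos b)%:E)%E.
Proof.
have -> : (\int[gam]_x (cos (a * x + b))%:E = (C a b)%:E)%E.
  rewrite /C /Rintegral fineK//.
  exact: (integrable_fin_num measurableT (integrable_cos a b)).
congr EFin.
have d0 x : is_derive x 1 (fun t => expR (t ^+ 2 / 2) * C t b) 0.
  have h := is_deriveM (is_derive_expR_half_sqr x) (dC x b).
  by apply: (is_derive_eq h); rewrite /GRing.scale/=; ring.
have := is_derive_0_is_cst a 0 d0; rewrite expr0n/= mul0r expR0 mul1r.
have -> : C 0 b = cos b.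
  rewrite /C; under eq_Rintegral do rewrite mul0r add0r.
  rewrite Rintegral_cst//= probability_setT; exact: mulr1.
move=> <-; rewrite mulrA -expRD mulNr addrC subrr.
by rewrite expR0 mul1r.
Qed.

End gaussian_characteristic.

(** * Random variables with a Gaussian law *)

Section gaussian_variables.
Context {disp : measure_display} {T : measurableType disp} {R : realType}.
Variable P : probability T R.
Local Notation gam := (normal_prob (0 : R) 1).
Implicit Types (X : T -> R) (m s a b c t v : R).

(* X has the law of m + s * xi, with xi standard Gaussian; s = 0 is allowed. *)
Definition gaussian_repr X m s := forall G : R -> R,
  continuous G -> (forall x, 0 <= G x) ->
  (\int[P]_w (G (X w))%:E = \int[gam]_x (G (m + s * x))%:E)%E.

(** The Dirac branch of [gaussian] is absorbed here: for s = 0 the right-hand integrand is the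
    constant G m, so later arguments need no case distinction on the variance. *)
Lemma gaussian_reprP X : measurable_fun setT X -> gaussian P X ->
  exists m s, 0 <= s /\ gaussian_repr X m s.
Proof.
move=> mX0 [m [s [s0 XE]]]; exists m, s; split => // G cG G0.
have mG := continuous_measurableT cG.
have mEG : measurable_fun [set: measurableTypeR R] (EFin \o G).
  exact/measurable_EFinP.
have mX : measurable_fun setT (X : T -> measurableTypeR R) := mX0.
have push (Q : probability (measurableTypeR R) R) :
    (forall B, measurable B -> P (X @^-1` B) = Q B) ->
    (\int[P]_w (G (X w))%:E = \int[Q]_x (G x)%:E)%E.
  move=> QE; rewrite -(ge0_integral_pushforward mX _ _ mEG)//=; last first.
    by move=> x _; rewrite lee_fin.
  by apply: eq_measure_integral => //= A mA _; exact: QE.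
have [s00|sn0] := eqVneq s 0.
  rewrite (push (\d_(m : measurableTypeR R))); last first.
    by move=> A mA; have := XE _ mA; rewrite s00 eqxx.
  rewrite integral_dirac// diracT mul1e.
  transitivity (\int[gam]_x (G m)%:E)%E.
    by rewrite integral_cst//= probability_setT mule1.
  by apply: eq_integral => x _; rewrite s00 mul0r addr0.
rewrite (push (normal_prob m s)); last first.
  by move=> A mA; have := XE _ mA; rewrite (negbTE sn0).
by rewrite (integral_normal_affine m _ cG G0)// lt0r sn0.
Qed.

Lemma gaussian_repr_shift X m s a :
  gaussian_repr X m s -> gaussian_repr (fun w => X w - a) (m - a) s.
Proof.
move=> H G cG G0.
rewrite (H (fun x => G (x - a))) => [||//].
  by apply: eq_integral => x _; rewrite addrAC.
move=> x; apply: continuous_comp; last exact: cG.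
by apply: cvgD; [exact: cvg_id|exact: cvg_cst].
Qed.

Lemma gaussian_expR X m s c : gaussian_repr X m s ->
  (\int[P]_w (expR (c * X w))%:E = (expR (c * m + c ^+ 2 * s ^+ 2 / 2))%:E)%E.
Proof.
move=> /(_ _ (@continuous_expRM R c) (fun=> expR_ge0 _)) ->.
transitivity ((expR (c * m))%:E * \int[gam]_x (expR (c * s * x))%:E)%E.
  rewrite -ge0_integralZl//.
  - apply: eq_integral => x _; rewrite -EFinM -expRD.
    by congr (expR _)%:E; ring.
  - apply/measurable_EFinP.
    exact: (continuous_measurableT (@continuous_expRM R (c * s))).
rewrite integral_gauss_expR -EFinM -expRD; congr (expR _)%:E.
by rewrite exprMn.
Qed.

Lemma gaussian_cos X m s b : measurable_fun setT X -> gaussian_repr X m s ->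
  (\int[P]_w (cos (X w + b))%:E = (expR (- s ^+ 2 / 2) * cos (m + b))%:E)%E.
Proof.
move=> mX H.
have mc : continuous (fun x : R => m + s * x).
  by move=> x; apply: cvgD; [exact: cvg_cst|apply: cvgM; [exact: cvg_cst|exact: cvg_id]].
have H1 : forall G : R -> R, continuous G -> (forall x, 0 <= G x) ->
    (\int[P]_w (cst 1 w * G (X w))%:E =
     1%:E * \int[gam]_x (G (m + s * x))%:E)%E.
  move=> G cG G0; rewrite mul1e -H//.
  by apply: eq_integral => w _; rewrite /= mul1r.
have cc : continuous (fun x : R => cos (x + b)).
  rewrite (_ : (fun x => _) = (fun x : R => cos (1 * x + b))).
    exact: continuous_cos_affine.
  by apply/funext => x; rewrite mul1r.
have c1 (x : R) : `|cos (x + b)| <= 1 by exact: cos_max.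
have := @bounded_integral_transfer R _ _ _ _ P gam (cst 1) X
  (fun x => m + s * x) 1 (measurable_cst _) mX
  (continuous_measurableT mc) (fun=> ler01) H1 _ cc c1.
rewrite mul1e; under eq_integral do rewrite /= mul1r.
move=> ->; rewrite -integral_gauss_cos.
by apply: eq_integral => x _; congr (cos _)%:E; ring.
Qed.

Lemma gaussian_expRsqr X s t : measurable_fun setT X -> gaussian_repr X 0 s ->
  0 < 1 + 2 * (t * s ^+ 2) ->
  (\int[P]_w (expR (- t * X w ^+ 2))%:E =
   ((Num.sqrt (1 + 2 * (t * s ^+ 2)))^-1)%:E)%E.
Proof.
move=> mX H ts; rewrite -integral_gauss_expRsqr//.
rewrite (H _ (@continuous_expRMsqr R (- t)) (fun=> expR_ge0 _)).
apply: eq_integral => x _; congr (expR _)%:E; ring.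
Qed.

(** If a were nonzero, t = a / q with q = K + 1 + |a| / e would be admissible and would force q <=
    K. Since a has unknown sign, t must be allowed both signs. *)
Lemma small_quadratic_eq0 (a K e : R) : 0 < e -> 0 <= K ->
  (forall t, `|t| < e -> t * a <= t ^+ 2 * K) -> a = 0.
Proof.
move=> e0 K0 H; apply/eqP; apply: contraT => an0.
have a0 : 0 < `|a| by rewrite normr_gt0.
pose q := K + 1 + `|a| / e.
have ae0 : 0 < `|a| / e by rewrite divr_gt0.
have q0 : 0 < q by rewrite /q; lra.
have aq : `|a / q| < e.
  rewrite normrM normfV (gtr0_norm q0) ltr_pdivrMr// mulrC -ltr_pdivrMr//.
  by rewrite /q; lra.
have := H _ aq.
have -> : a / q * a = a ^+ 2 / q by field; rewrite gt_eqF.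
have -> : (a / q) ^+ 2 * K = a ^+ 2 / q * (K / q) by field; rewrite gt_eqF.
have a2 : 0 < a ^+ 2 / q by rewrite divr_gt0// exprn_even_gt0.
rewrite -[leLHS]mulr1 ler_pM2l// ler_pdivlMr// mul1r /q => h; lra.
Qed.

Lemma gaussian_integrable_expRsqr X s : measurable_fun setT X ->
  gaussian_repr X 0 s ->
  exists2 t, 0 < t & P.-integrable setT (EFin \o (fun w => expR (t * X w ^+ 2))).
Proof.
(* This choice keeps t s^2 <= 1/4, hence 1 - 2 t s^2 > 0, and makes sense for s = 0 as well. *)
move=> mX H; pose t := (4 * (1 + s ^+ 2))^-1.
have s20 : 0 <= s ^+ 2 by exact: sqr_ge0.
have t0 : 0 < t by rewrite invr_gt0; lra.
exists t => //; apply/integrableP; split.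
  apply/measurable_EFinP/(measurableT_comp (@measurable_expR R)).
  by apply: measurable_funM => //; exact: measurable_funX.
under eq_integral do rewrite /= ger0_norm ?expR_ge0//.
have := @gaussian_expRsqr X s (- t) mX H; rewrite opprK => ->; first exact: ltry.
have : t * s ^+ 2 <= 4^-1; last by lra.
rewrite /t invfM -mulrA ler_piMr// mulrC ler_pdivrMr; lra.
Qed.

Lemma gaussian_integrable_sqr X s : measurable_fun setT X ->
  gaussian_repr X 0 s ->
  P.-integrable setT (EFin \o (fun w => X w ^+ 2)).
Proof.
move=> mX H; have [t t0 it] := gaussian_integrable_expRsqr mX H.
apply: (@le_integrable _ _ _ _ _ measurableT _
    (fun w => (t^-1)%:E * (EFin \o (fun w => expR (t * X w ^+ 2))) w)%E).
- by apply/measurable_EFinP; exact: measurable_funX.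
- move=> w _; rewrite /= lee_fin !ger0_norm ?sqr_ge0//; last first.
    by rewrite mulr_ge0 ?expR_ge0// invr_ge0 ltW.
  rewrite ler_pdivlMl//; apply: le_trans (expR_ge1Dx _).
  by rewrite lerDr.
- exact: integrableZl.
Qed.

Lemma gaussian_integrable X s : measurable_fun setT X ->
  gaussian_repr X 0 s -> P.-integrable setT (EFin \o X).
Proof.
move=> mX H; have iX2 := gaussian_integrable_sqr mX H.
have i1 : P.-integrable setT (EFin \o (fun=> 1 : R)).
  exact: finite_measure_integrable_cst.
apply: (@le_integrable _ _ _ _ _ measurableT _
    (EFin \o (fun w => 1 + X w ^+ 2))).
- exact/measurable_EFinP.
- move=> w _; rewrite /= lee_fin [leRHS]ger0_norm ?addr_ge0 ?sqr_ge0//.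
  rewrite ler_norml; have := sqr_ge0 (X w + 1); have := sqr_ge0 (X w - 1).
  by rewrite !sqrrD; lra.
- rewrite (_ : _ \o _ = (fun w => (EFin \o (fun=> 1%R)) w +
    (EFin \o (fun w => (X w ^+ 2)%R)) w)%E)//.
  exact: integrableD.
Qed.

(* For a Gaussian X the mean and the variance are read off the transforms to first
   order, from 1 + c X <= exp(c X) and 1 - t X^2 <= exp(-t X^2) with c and t small
   of either sign. *)
Lemma gaussian_mean0 X s : measurable_fun setT X ->
  gaussian_repr X 0 s -> \int[P]_w X w = 0.
Proof.
move=> mX H; have iX := gaussian_integrable mX H.
set mu := Rintegral _ _ _.
have muE : (\int[P]_w (X w)%:E = mu%:E)%E.
  by rewrite /mu /Rintegral fineK//; exact: (integrable_fin_num measurableT iX).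
have i1 : P.-integrable setT (EFin \o (fun=> 1 : R)).
  exact: finite_measure_integrable_cst.
have key c : 1 + c * mu <= expR (c ^+ 2 * s ^+ 2 / 2).
  have := gaussian_expR c H; rewrite mulr0 add0r -lee_fin => <-.
  have icX : P.-integrable setT (EFin \o (fun w => c * X w)).
    by rewrite (_ : _ \o _ = (fun w => c%:E * (EFin \o X) w)%E)//; exact: integrableZl.
  have -> : ((1 + c * mu)%:E = \int[P]_w (1 + c * X w)%:E)%E.
    under eq_integral do rewrite EFinD.
    rewrite integralD//= integral_cst//= probability_setT mule1.
    under eq_integral do rewrite EFinM.
    by rewrite integralZl// muE.
  apply: le_integral => //.
  - rewrite (_ : (fun w => _) = (fun w => (EFin \o (fun=> 1%R)) w +
      (EFin \o (fun w => (c * X w)%R)) w)%E)//.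
    exact: integrableD.
  - apply/integrableP; split.
      apply/measurable_EFinP/(measurableT_comp (@measurable_expR R)).
      exact: measurable_funM.
    under eq_integral do rewrite /= ger0_norm ?expR_ge0//.
    by rewrite (gaussian_expR c H) ltry.
  - by move=> w _; rewrite lee_fin expR_ge1Dx.
have s20 : 0 <= s ^+ 2 by exact: sqr_ge0.
apply: (@small_quadratic_eq0 _ (s ^+ 2 / 2 * (1 + `|mu|)) (1 + s ^+ 2)^-1).
- by rewrite invr_gt0; lra.
- by rewrite mulr_ge0 ?addr_ge0// divr_ge0.
move=> c ce.
have c1 : `|c| <= 1.
  by apply/ltW/(lt_le_trans ce); rewrite invf_le1; lra.
set u := c ^+ 2 * s ^+ 2 / 2.
have u0 : 0 <= u by rewrite /u divr_ge0// mulr_ge0// sqr_ge0.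
have u1 : 1 - u > 0.
  have : c ^+ 2 * s ^+ 2 <= 1; last by rewrite /u; lra.
  have : c ^+ 2 <= `|c|.
    by rewrite -[leLHS]ger0_norm ?sqr_ge0// expr2 normrM ler_piMr.
  move: ce; rewrite -[X in _ < X]mul1r ltr_pdivlMr; last by lra.
  have := normr_ge0 c; nra.
have h := key c; rewrite -/u in h.
(* Since exp(u) <= 1/(1 - u), [key] becomes c mu <= u (1 + c mu) with u = c^2 s^2 / 2, a bound of
   second order in c. *)
have h2 : expR u * (1 - u) <= 1.
  apply: (@le_trans _ _ (expR u * expR (- u))).
    by rewrite ler_wpM2l ?expR_ge0// expR_ge1Dx.
  by rewrite -expRD subrr expR0.
have h3 : (1 + c * mu) * (1 - u) <= 1.
  by apply: le_trans h2; rewrite ler_pM2r.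
have h4 : c * mu <= u * (1 + c * mu) by lra.
apply: (le_trans h4).
rewrite (_ : c ^+ 2 * _ = u * (1 + `|mu|)); last by rewrite /u; field.
rewrite ler_wpM2l// lerD2l; apply: le_trans (ler_norm _) _.
by rewrite normrM ler_piMl.
Qed.

Lemma gaussian_mean_sqr X s : measurable_fun setT X ->
  gaussian_repr X 0 s -> \int[P]_w (X w ^+ 2) = s ^+ 2.
Proof.
move=> mX H; have iX := gaussian_integrable_sqr mX H.
set v := Rintegral _ _ _.
have v0 : 0 <= v by apply: Rintegral_ge0 => w _; exact: sqr_ge0.
have vE : (\int[P]_w (X w ^+ 2)%:E = v%:E)%E.
  by rewrite /v /Rintegral fineK//; exact: (integrable_fin_num measurableT iX).
have i1 : P.-integrable setT (EFin \o (fun=> 1 : R)).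
  exact: finite_measure_integrable_cst.
have s20 : 0 <= s ^+ 2 by exact: sqr_ge0.
have key t : 0 < 1 + 2 * (t * s ^+ 2) ->
    1 - t * v <= (Num.sqrt (1 + 2 * (t * s ^+ 2)))^-1.
  move=> t0; rewrite -lee_fin -(gaussian_expRsqr mX H t0).
  have icX : P.-integrable setT (EFin \o (fun w => - t * X w ^+ 2)).
    rewrite (_ : _ \o _ =
      (fun w => (- t)%:E * (EFin \o (fun w => (X w ^+ 2)%R)) w)%E)//.
    exact: integrableZl.
  have -> : ((1 - t * v)%:E = \int[P]_w (1 + - t * X w ^+ 2)%:E)%E.
    under eq_integral do rewrite EFinD.
    rewrite integralD//= integral_cst//= probability_setT mule1.
    under eq_integral do rewrite EFinM.
    by rewrite integralZl// vE -EFinM -EFinD mulNr.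
  apply: le_integral => //.
  - rewrite (_ : (fun w => _) = (fun w => (EFin \o (fun=> 1%R)) w +
      (EFin \o (fun w => (- t * X w ^+ 2)%R)) w)%E)//.
    exact: integrableD.
  - apply/integrableP; split.
      apply/measurable_EFinP/(measurableT_comp (@measurable_expR R)).
      by apply: measurable_funM => //; exact: measurable_funX.
    under eq_integral do rewrite /= ger0_norm ?expR_ge0//.
    by rewrite (gaussian_expRsqr mX H t0) ltry.
  - by move=> w _; rewrite lee_fin expR_ge1Dx.
apply/eqP; rewrite -subr_eq0; apply/eqP.
apply: (@small_quadratic_eq0 _ (4 * v * s ^+ 2 + 2 * v ^+ 2 * s ^+ 2)
    (1 + 4 * s ^+ 2 + v)^-1).
- by rewrite invr_gt0; lra.
- by have := mulr_ge0 v0 s20; have := mulr_ge0 (sqr_ge0 v) s20; lra.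
move=> t; rewrite -[X in _ < X]mul1r ltr_pdivlMr; last by lra.
move=> te; have tn := normr_ge0 t.
have tl : `|t| <= 1 by nra.
have [t1 t2] : - 1 <= t /\ t <= 1 by apply/andP; rewrite -ler_norml.
have tv : `|t * v| <= 1 by rewrite normrM (ger0_norm v0); nra.
have ts : `|t * s ^+ 2| <= 4^-1 by rewrite normrM (ger0_norm s20); nra.
move: tv; rewrite ler_norml => /andP[tv1 tv2].
move: ts; rewrite ler_norml => /andP[ts1 ts2].
have p1 : 0 < 1 + 2 * (- t * s ^+ 2) by lra.
have h := key _ p1; set D := 1 + 2 * (- t * s ^+ 2) in p1 h.
(* This is [key] at - t, squared to remove the root. Expanded, it bounds 2 t (v - s^2) by terms of
   order t^2. *)
have h2 : (1 + t * v) ^+ 2 * D <= 1.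
  have q0 : 0 < Num.sqrt D by rewrite sqrtr_gt0.
  have : (1 - - t * v) * Num.sqrt D <= 1.
    by rewrite -ler_pdivlMr// div1r.
  have w0 : 0 <= (1 - - t * v) * Num.sqrt D
    by apply: mulr_ge0; [rewrite mulNr; lra|exact: ltW].
  move=> h3; have := ler_pM w0 w0 h3 h3; rewrite mul1r -expr2 exprMn sqr_sqrtr ?(ltW p1)//.
  by rewrite mulNr opprK.
suff : 0 <= t ^+ 2 * v ^+ 2 /\
    t ^+ 2 * (2 * t * v ^+ 2 * s ^+ 2) <= t ^+ 2 * (2 * v ^+ 2 * s ^+ 2).
  move: h2; rewrite /D => h2 [h3 h4]; nra.
split; first by rewrite mulr_ge0 ?sqr_ge0.
rewrite ler_wpM2l ?sqr_ge0//.
have : 0 <= v ^+ 2 * s ^+ 2 by rewrite mulr_ge0 ?sqr_ge0.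
nra.
Qed.

End gaussian_variables.

(** * Independent Gaussian families *)

Section gaussian_family.
Context {disp : measure_display} {T : measurableType disp} {R : realType}.
Variable P : probability T R.
Local Notation gam := (normal_prob (0 : R) 1).

(** This is the integral over the auxiliary g left at each step of [family_laplace_cos]: the weight
    comes from the variance of the removed coordinate, the cosine from its mean. *)
Lemma integral_gauss_expRsqr_cos (t a b : R) : 0 < 1 + 2 * t ->
  (\int[gam]_x (expR (- t * x ^+ 2) * cos (a * x + b))%:E =
   ((Num.sqrt (1 + 2 * t))^-1 * expR (- a ^+ 2 / (2 * (1 + 2 * t))) * cos b)%:E)%E.
Proof.
move=> t0; set s := (Num.sqrt _)^-1.
have mc : continuous (fun x : R => 0 + s * x).
  by move=> x; apply: cvgD; [exact: cvg_cst|apply: cvgM; [exact: cvg_cst|exact: cvg_id]].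
have H := @bounded_integral_transfer R _ _ _ _ gam gam (fun x => expR (- t * x ^+ 2)) id
  (fun x => 0 + s * x) s
  (continuous_measurableT (@continuous_expRMsqr R (- t))) (@measurable_id _ _ _)
  (continuous_measurableT mc) (fun=> expR_ge0 _)
  (fun G => @ge0_integral_gauss_scale R t G t0)
  _ (@continuous_cos_affine R a b) (fun=> cos_max _).
rewrite H -mulrA EFinM; congr (_ * _)%E.
transitivity (\int[gam]_x (cos (a * s * x + b))%:E)%E.
  by apply: eq_integral => x _; congr (cos _)%:E; ring.
rewrite integral_gauss_cos; congr (expR _ * _)%:E.
rewrite exprMn /s exprVn sqr_sqrtr ?ltW//; field.
by have := t0; rewrite lt0r => /andP[].
Qed.

Context {I : eqType}.
Implicit Types (s r : seq I) (y : I -> T -> R) (th c : I -> R) (t v : R).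

(* By the Cramer-Wold device: the y i, i in s, are independent N(th i, v). *)
Definition gaussian_family s y th v := forall c,
  gaussian_repr P (fun w => \sum_(i <- s) c i * y i w)
    (\sum_(i <- s) c i * th i) (Num.sqrt (v * \sum_(i <- s) c i ^+ 2)).

Lemma sum_update s k (a : R) c (z : I -> R) : uniq s -> k \in s ->
  \sum_(i <- s) (c i + (i == k)%:R * a) * z i = \sum_(i <- s) c i * z i + a * z k.
Proof.
move=> us ks; under eq_bigr do rewrite mulrDl.
rewrite big_split/=; congr (_ + _).
rewrite (bigD1_seq k)//= eqxx mul1r big1 ?addr0// => i /negbTE ->.
by rewrite !mul0r.
Qed.

Lemma sum_update_sqr s k (a : R) c : uniq s -> k \in s -> c k = 0 ->
  \sum_(i <- s) (c i + (i == k)%:R * a) ^+ 2 = \sum_(i <- s) c i ^+ 2 + a ^+ 2.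
Proof.
move=> us ks ck0; rewrite [LHS](bigD1_seq k)//= [in RHS](bigD1_seq k)//=.
rewrite eqxx ck0 mul1r add0r expr0n/= add0r addrC; congr (_ + _).
by apply: eq_bigr => i /negbTE ->; rewrite mul0r addr0.
Qed.

Variables (s : seq I) (y : I -> T -> R) (th : I -> R) (v : R).
Hypothesis us : uniq s.
Hypothesis my : forall i, measurable_fun setT (y i).
Hypothesis v0 : 0 <= v.
Hypothesis gf : gaussian_family s y th v.

Let mlin c : measurable_fun setT (fun w => \sum_(i <- s) c i * y i w).
Proof. by apply: measurable_sum => i; exact: measurable_funM. Qed.

Let mexp r t : measurable_fun setT (fun w => expR (t * \sum_(i <- r) y i w ^+ 2)).
Proof.
apply: (measurableT_comp (@measurable_expR R)); apply: measurable_funM => //.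
by apply: measurable_sum => i; exact: measurable_funX.
Qed.

Let sqrc_ge0 c : 0 <= \sum_(i <- s) c i ^+ 2.
Proof. by apply: sumr_ge0 => i _; exact: sqr_ge0. Qed.

Lemma family_cos c b :
  (\int[P]_w (cos (\sum_(i <- s) c i * y i w + b))%:E =
   (expR (- (v * \sum_(i <- s) c i ^+ 2) / 2) *
    cos (\sum_(i <- s) c i * th i + b))%:E)%E.
Proof.
rewrite (gaussian_cos b (mlin c) (gf c)) sqr_sqrtr//.
by rewrite mulr_ge0.
Qed.

Lemma family_expR c :
  (\int[P]_w (expR (\sum_(i <- s) c i * y i w))%:E =
   (expR (\sum_(i <- s) c i * th i + v * (\sum_(i <- s) c i ^+ 2) / 2))%:E)%E.
Proof.
have := gaussian_expR 1 (gf c); rewrite expr1n !mul1r sqr_sqrtr ?mulr_ge0//.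
by under eq_integral do rewrite mul1r.
Qed.

(* exp(-t y^2) is the average of cos(sqrt(2t) g y) over a standard Gaussian g. *)
Lemma family_laplace_cos t r c b : 0 <= t -> uniq r -> {subset r <= s} ->
  (forall i, i \in r -> c i = 0) ->
  (\int[P]_w (expR (- t * \sum_(i <- r) y i w ^+ 2) *
              cos (\sum_(i <- s) c i * y i w + b))%:E =
   ((\prod_(i <- r) ((Num.sqrt (1 + 2 * (t * v)))^-1 *
        expR (- t * th i ^+ 2 / (1 + 2 * (t * v))))) *
    (expR (- (v * \sum_(i <- s) c i ^+ 2) / 2) *
    cos (\sum_(i <- s) c i * th i + b)))%:E)%E.
Proof.
move=> t0; have tv1 : 0 < 1 + 2 * (t * v).
  by have := mulr_ge0 t0 v0; lra.
elim: r c b => [|k r IH] c b ur rs c0.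
  rewrite big_nil mul1r; apply: etrans (family_cos c b).
  by apply: eq_integral => w _; rewrite big_nil mulr0 expR0 mul1r.
move: ur => /= /andP[kr ur].
have ks : k \in s by apply: rs; rewrite mem_head.
have rs' : {subset r <= s} by move=> i ir; apply: rs; rewrite inE ir orbT.
have ck0 : c k = 0 by apply: c0; rewrite mem_head.
pose q := Num.sqrt (2 * t).
have q2 : q ^+ 2 = 2 * t by rewrite sqr_sqrtr// mulr_ge0.
(* The square of y_k is traded for a coefficient q g on y_k. As c vanishes at k, the sum of squared
   coefficients grows by exactly (q g)^2; as k is not in r, c' still vanishes on r. *)
pose c' g i := c i + (i == k)%:R * (q * g).
have c'0 g i : i \in r -> c' g i = 0.
  move=> ir; rewrite /c' c0 ?inE ?ir ?orbT// add0r.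
  case: eqP => [ik|_]; last by rewrite mul0r.
  by move: kr; rewrite -ik ir.
pose F (z : T * measurableTypeR R) : \bar R :=
  (expR (- t * \sum_(i <- r) y i z.1 ^+ 2) *
   cos (\sum_(i <- s) c i * y i z.1 + q * (z.2 : R) * y k z.1 + b))%:E.
have mF : measurable_fun setT F.
  apply/measurable_EFinP/measurable_funM.
    exact: (measurableT_comp (mexp r (- t)) measurable_fst).
  apply: (measurableT_comp (continuous_measurableT (@continuous_cos R))).
  apply: measurable_funD => //; apply: measurable_funD.
    exact: (measurableT_comp (mlin c) measurable_fst).
  apply: measurable_funM.
    by apply: measurable_funM => //; exact: measurable_snd.
  exact: (measurableT_comp (my k) measurable_fst).
have iF : (P \x gam)%E.-integrable setT F.
  apply: (@le_integrable _ _ _ _ _ measurableT _ (EFin \o (fun=> 1%R))) => //.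
    move=> z _ /=; rewrite lee_fin normr1 normrM ger0_norm ?expR_ge0//.
    rewrite -[leRHS]mulr1 ler_pM ?expR_ge0 ?cos_max//.
    rewrite -expR0 ler_expR mulNr oppr_le0 mulr_ge0// sumr_ge0// => i _.
    exact: sqr_ge0.
  apply/integrableP; split; first exact: measurable_cst.
  under eq_integral do rewrite /= normr1.
  have pT : (P \x gam)%E [set: T * measurableTypeR R] = 1%E.
    rewrite -setXTT product_measure1E//=.
    by rewrite !probability_setT mule1.
  by rewrite integral_cst// mul1e; move: pT => /= ->; exact: ltry.
transitivity (\int[P]_w \int[gam]_g F (w, g))%E.
  apply: eq_integral => w _; rewrite /F/=.
  set E := expR (- t * \sum_(i <- r) _).
  transitivity (E%:E * \int[gam]_g
      (cos (q * y k w * g + (\sum_(i <- s) c i * y i w + b)))%:E)%E.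
    rewrite integral_gauss_cos -EFinM; congr EFin; rewrite mulrA; congr (_ * _).
    rewrite big_cons mulrDr expRD mulrC; congr (_ * expR _).
    by rewrite exprMn q2; field.
  rewrite -integralZl//.
    by apply: eq_integral => g _; rewrite -EFinM; congr (_ * cos _)%:E; ring.
  apply: (@le_integrable _ _ _ _ _ measurableT _ (EFin \o (fun=> 1%R))) => //.
  - apply/measurable_EFinP.
    exact: (continuous_measurableT (@continuous_cos_affine R _ _)).
  - by move=> g _ /=; rewrite lee_fin normr1; exact: cos_max.
  - exact: finite_measure_integrable_cst.
rewrite (Fubini iF).
pose K i := (Num.sqrt (1 + 2 * (t * v)))^-1 *
        expR (- t * th i ^+ 2 / (1 + 2 * (t * v))).
set B := \sum_(i <- s) c i * th i + b.
pose D := \prod_(i <- r) K i.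
set E := expR (- (v * \sum_(i <- s) c i ^+ 2) / 2).
transitivity (\int[gam]_g ((D * E)%:E *
  (expR (- (t * v) * g ^+ 2) * cos (q * th k * g + B))%:E))%E.
  apply: eq_integral => g _; rewrite /F/=.
  transitivity (\int[P]_w (expR (- t * \sum_(i <- r) y i w ^+ 2) *
     cos (\sum_(i <- s) c' g i * y i w + b))%:E)%E.
    by apply: eq_integral => w _; rewrite sum_update.
  rewrite (IH (c' g) b ur rs' (c'0 g)) -[\prod_(_ <- _) _]/D.
  rewrite (sum_update_sqr (q * g) us ks ck0) (sum_update _ _ th us ks).
  rewrite -EFinM exprMn q2; congr EFin; rewrite -[RHS]mulrA; congr (_ * _).
  rewrite [RHS]mulrA -expRD; congr (expR _ * cos _); first by field.
  by rewrite /B; ring.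
rewrite integralZl//.
  rewrite integral_gauss_expRsqr_cos// -EFinM; congr EFin.
  rewrite big_cons -[\prod_(_ <- _) _]/D exprMn q2 -/B.
  rewrite (_ : - (2 * t * th k ^+ 2) / (2 * (1 + 2 * (t * v))) =
     - t * th k ^+ 2 / (1 + 2 * (t * v))); last first.
    by field; have := tv1; rewrite lt0r => /andP[].
  by rewrite /K; ring.
apply: (@le_integrable _ _ _ _ _ measurableT _ (EFin \o (fun=> 1%R))) => //.
- apply/measurable_EFinP/measurable_funM.
    exact: (continuous_measurableT (@continuous_expRMsqr R _)).
  exact: (continuous_measurableT (@continuous_cos_affine R _ _)).
- move=> g _ /=; rewrite lee_fin normr1 normrM ger0_norm ?expR_ge0//.
  rewrite -[leRHS]mulr1 ler_pM ?expR_ge0 ?cos_max//.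
  rewrite -expR0 ler_expR mulNr oppr_le0 mulr_ge0//; last exact: sqr_ge0.
  exact: mulr_ge0.
- exact: finite_measure_integrable_cst.
Qed.

Lemma family_laplace t : 0 <= t ->
  (\int[P]_w (expR (- t * \sum_(i <- s) y i w ^+ 2))%:E =
   ((Num.sqrt (1 + 2 * (t * v)))^-1 ^+ size s *
    expR (- t * (\sum_(i <- s) th i ^+ 2) / (1 + 2 * (t * v))))%:E)%E.
Proof.
move=> t0; pose z0 (i : I) : R := 0.
have := @family_laplace_cos t s z0 0 t0 us (fun _ h => h) (fun _ _ => erefl).
have s0 (z : I -> R) : \sum_(i <- s) z0 i * z i = 0.
  by rewrite big1// => i _; rewrite mul0r.
have -> : \sum_(i <- s) z0 i ^+ 2 = 0 by rewrite big1// => i _; rewrite expr0n.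
rewrite (s0 th) mulr0 oppr0 mul0r expR0 addr0 cos0 !mulr1 big_split/=.
rewrite big_const_seq count_predT iter_mulr_1 => H.
transitivity (\int[P]_w (expR (- t * \sum_(i <- s) y i w ^+ 2) *
              cos (\sum_(i <- s) z0 i * y i w + 0))%:E)%E.
  by apply: eq_integral => w _; rewrite s0 addr0 cos0 mulr1.
rewrite H; congr (_ * _)%:E.
rewrite -expR_sum; congr expR.
by rewrite mulr_sumr mulr_suml.
Qed.

(* exp(t y^2) is the average of exp(sqrt(2t) g y) over a standard Gaussian g. *)
Lemma family_mgf_expR t r c : 0 <= t -> 0 < 1 - 2 * (t * v) ->
  (forall i, i \in s -> th i = 0) -> uniq r -> {subset r <= s} ->
  (forall i, i \in r -> c i = 0) ->
  (\int[P]_w (expR (t * \sum_(i <- r) y i w ^+ 2) *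
              expR (\sum_(i <- s) c i * y i w))%:E =
   ((Num.sqrt (1 - 2 * (t * v)))^-1 ^+ size r *
    expR (v * (\sum_(i <- s) c i ^+ 2) / 2))%:E)%E.
Proof.
move=> t0 tv1 th0.
have thc c' : \sum_(i <- s) c' i * th i = 0.
  by rewrite big_seq big1// => i /th0 ->; rewrite mulr0.
elim: r c => [|k r IH] c ur rs c0.
  rewrite expr0 mul1r.
  have := family_expR c; rewrite thc add0r => <-.
  by apply: eq_integral => w _; rewrite big_nil mulr0 expR0 mul1r.
move: ur => /= /andP[kr ur].
have ks : k \in s by apply: rs; rewrite mem_head.
have rs' : {subset r <= s} by move=> i ir; apply: rs; rewrite inE ir orbT.
have ck0 : c k = 0 by apply: c0; rewrite mem_head.
pose q := Num.sqrt (2 * t).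
have q2 : q ^+ 2 = 2 * t by rewrite sqr_sqrtr// mulr_ge0.
pose c' g i := c i + (i == k)%:R * (q * g).
have c'0 g i : i \in r -> c' g i = 0.
  move=> ir; rewrite /c' c0 ?inE ?ir ?orbT// add0r.
  case: eqP => [ik|_]; last by rewrite mul0r.
  by move: kr; rewrite -ik ir.
pose F (z : T * measurableTypeR R) : \bar R :=
  (expR (t * \sum_(i <- r) y i z.1 ^+ 2) *
   expR (\sum_(i <- s) c i * y i z.1 + q * (z.2 : R) * y k z.1))%:E.
have F0 z : (0 <= F z)%E by rewrite lee_fin mulr_ge0 ?expR_ge0.
have mF : measurable_fun setT F.
  apply/measurable_EFinP/measurable_funM.
    exact: (measurableT_comp (mexp r t) measurable_fst).
  apply: (measurableT_comp (@measurable_expR R)); apply: measurable_funD.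
    exact: (measurableT_comp (mlin c) measurable_fst).
  apply: measurable_funM.
    by apply: measurable_funM => //; exact: measurable_snd.
  exact: (measurableT_comp (my k) measurable_fst).
transitivity (\int[P]_w \int[gam]_g F (w, g))%E.
  apply: eq_integral => w _; rewrite /F/=.
  set E := expR (t * \sum_(i <- r) _).
  transitivity ((E * expR (\sum_(i <- s) c i * y i w))%:E *
      \int[gam]_g (expR (q * y k w * g))%:E)%E.
    rewrite integral_gauss_expR -EFinM; congr EFin; rewrite [RHS]mulrAC.
    congr (_ * _); rewrite big_cons mulrDr expRD mulrC; congr (_ * expR _).
    by rewrite exprMn q2; field.
  rewrite -ge0_integralZl//.
  - apply: eq_integral => g _; rewrite -EFinM; congr EFin.
    by rewrite -[LHS]mulrA -expRD; congr (_ * expR _); ring.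
  - apply/measurable_EFinP.
    exact: (continuous_measurableT (@continuous_expRM R _)).
  - by rewrite lee_fin mulr_ge0 ?expR_ge0.
(* The integrand is nonnegative, so the exchange is legitimate before any integrability is known. *)
rewrite (fubini_tonelli _ mF F0).
set S := Num.sqrt _; set E := expR (v * (\sum_(i <- s) c i ^+ 2) / 2).
transitivity (\int[gam]_g ((S^-1 ^+ size r * E)%:E *
  (expR (- (- (t * v)) * g ^+ 2))%:E))%E.
  apply: eq_integral => g _; rewrite /F/=.
  transitivity (\int[P]_w (expR (t * \sum_(i <- r) y i w ^+ 2) *
     expR (\sum_(i <- s) c' g i * y i w))%:E)%E.
    by apply: eq_integral => w _; rewrite sum_update.
  rewrite (IH (c' g) ur rs' (c'0 g)) sum_update_sqr// exprMn q2.
  rewrite -EFinM; congr EFin; rewrite -[RHS]mulrA -expRD.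
  by congr (_ * expR _); field.
rewrite ge0_integralZl//.
- rewrite integral_gauss_expRsqr ?mulrN// -EFinM; congr EFin.
  by rewrite exprS mulrC mulrA.
- apply/measurable_EFinP.
  exact: (continuous_measurableT (@continuous_expRMsqr R _)).
- by rewrite lee_fin mulr_ge0 ?expR_ge0// exprn_ge0// invr_ge0 sqrtr_ge0.
Qed.

Lemma family_mgf t : 0 <= t -> 0 < 1 - 2 * (t * v) ->
  (forall i, i \in s -> th i = 0) ->
  (\int[P]_w (expR (t * \sum_(i <- s) y i w ^+ 2))%:E =
   ((Num.sqrt (1 - 2 * (t * v)))^-1 ^+ size s)%:E)%E.
Proof.
move=> t0 tv th0.
have := @family_mgf_expR t s (fun=> 0) t0 tv th0 us (fun _ h => h) (fun _ _ => erefl).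
rewrite [in RHS]big1 => [|i _]; rewrite ?expr0n// mulr0 mul0r expR0 mulr1 => <-.
apply: eq_integral => w _; rewrite [X in _ * expR X]big1 ?expR0 ?mulr1// => i _.
by rewrite mul0r.
Qed.

End gaussian_family.

(** * Chi-square tail bounds *)

Section exponential_inequalities.
Context {R : realType}.

Lemma expR_ge_quadratic (z : R) : 0 <= z -> 1 + z + z ^+ 2 / 2 <= expR z.
Proof.
move=> z0; have nd : nondecreasing_seq (series (exp_coeff z)).
  apply/nondecreasing_seqP => n; rewrite seriesSr lerDl.
  by rewrite /exp_coeff/= divr_ge0// exprn_ge0.
apply: le_trans (nondecreasing_cvgn_le nd (@is_cvg_series_exp_coeff _ z) 3%N).
rewrite /series/= /exp_coeff !big_nat_recr//= big_nil.
by rewrite expr0 expr1 !divr1 add0r.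
Qed.

(** The quadratic minorant of exp(z) also bounds exp(-z) from above, because (1 + z + z^2/2)(1 - z +
    z^2/2) = 1 + z^4/4 >= 1. *)
Lemma sinh_ge (z : R) : 0 <= z -> 2 * z <= expR z - expR (- z).
Proof.
move=> z0; have h := expR_ge_quadratic z0.
have p0 : 0 < 1 + z + z ^+ 2 / 2 by have := sqr_ge0 z; lra.
have : expR (- z) <= (1 + z + z ^+ 2 / 2)^-1.
  by rewrite expRN lef_pV2 ?posrE ?expR_gt0.
have : (1 + z + z ^+ 2 / 2)^-1 <= 1 - z + z ^+ 2 / 2; last by lra.
rewrite -div1r ler_pdivrMr//.
have -> : (1 - z + z ^+ 2 / 2) * (1 + z + z ^+ 2 / 2) = 1 + z ^+ 4 / 4 by field.
by rewrite lerDl divr_ge0// exprn_even_ge0.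
Qed.

(** With z = - ln(1 - w) this is [sinh_ge]. At w = 2 t v the exponent is t v + (t v)^2/(1 - 2 t v),
    a form that the Chernoff bound can optimise in closed form. *)
Lemma invr_sqrt1B_le (w : R) : 0 <= w < 1 ->
  (Num.sqrt (1 - w))^-1 <= expR (w / 2 + w ^+ 2 / (4 * (1 - w))).
Proof.
move=> /andP[w0 w1]; have w10 : 0 < 1 - w by lra.
pose z := - ln (1 - w).
have z0 : 0 <= z by rewrite oppr_ge0 ln_le0//; lra.
have ez : expR (- z) = 1 - w by rewrite opprK lnK// posrE.
have h := sinh_ge z0; rewrite -[expR z]invrK -expRN ez in h.
have e : expR (z / 2) = (Num.sqrt (1 - w))^-1.
  rewrite -ez -sqrtrV ?expR_ge0// -expRN opprK.
  rewrite -[LHS]gtr0_norm ?expR_gt0// -sqrtr_sqr; congr Num.sqrt.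
  by rewrite expr2 -expRD; congr expR; field.
rewrite -e ler_expR.
suff <- : ((1 - w)^-1 - (1 - w)) / 4 = w / 2 + w ^+ 2 / (4 * (1 - w)) by lra.
by field; rewrite gt_eqF.
Qed.

(** After squaring, this is exp(-a) >= 1 - a at a = w/(1 + w), where 1 - a = 1/(1 + w). *)
Lemma invr_sqrt1D_le (w : R) : 0 <= w ->
  (Num.sqrt (1 + w))^-1 <= expR (- (w / (2 * (1 + w)))).
Proof.
move=> w0; have w1 : 0 < 1 + w by lra.
have e : expR (- (w / (2 * (1 + w)))) = Num.sqrt (expR (- (w / (1 + w)))).
  rewrite -[LHS]gtr0_norm ?expR_gt0// -sqrtr_sqr; congr Num.sqrt.
  by rewrite expr2 -expRD; congr expR; field; rewrite gt_eqF.
rewrite e -sqrtrV ?(ltW w1)// ler_sqrt ?expR_gt0//; apply: le_trans (expR_ge1Dx _).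
by rewrite le_eqVlt; apply/orP; left; apply/eqP; field; rewrite gt_eqF.
Qed.

End exponential_inequalities.

(** * Chernoff bounds for centred sums of squares *)

Section chi_square_tails.
Context {disp : measure_display} {T : measurableType disp} {R : realType}.
Variable P : probability T R.

Lemma markov_expR (A : set T) (u : T -> R) (a : R) :
  measurable A -> measurable_fun setT u -> (forall w, A w -> a <= u w) ->
  (P A <= (expR (- a))%:E * \int[P]_w (expR (u w))%:E)%E.
Proof.
move=> mA mu Au.
have me : measurable_fun setT (fun w => expR (u w)).
  exact: (measurableT_comp (@measurable_expR R)).
rewrite -ge0_integralZl//; first last.
- exact/measurable_EFinP.
rewrite -[leLHS]mul1e -integral_cst//; apply: (@le_trans _ _
  (\int[P]_(w in A) ((expR (- a))%:E * (expR (u w))%:E))%E).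
  apply: ge0_le_integral => //=.
  - by apply/measurable_EFinP/measurable_funTS/measurable_funM.
  - by move=> w /Au aw; rewrite -EFinM lee_fin -expRD -expR0 ler_expR; lra.
apply: ge0_subset_integral => //.
exact/measurable_EFinP/measurable_funM.
Qed.

Lemma measurable_set_ge (u : T -> R) (a : R) : measurable_fun setT u ->
  measurable [set w | a <= u w].
Proof.
move=> mu; rewrite (_ : [set w | _] = setT `&` u @^-1` `[a, +oo[%classic).
  by apply: mu => //; exact: measurable_itv.
by apply/seteqP; split => w /=; rewrite in_itv/= andbT // => -[].
Qed.

Lemma measurable_set_lt (u : T -> R) (a : R) : measurable_fun setT u ->
  measurable [set w | u w < a].
Proof.
move=> mu; rewrite (_ : [set w | _] = setT `&` u @^-1` `]-oo, a[%classic).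
  by apply: mu => //; exact: measurable_itv.
by apply/seteqP; split => w /=; rewrite in_itv/= // => -[].
Qed.

Context {I : eqType}.
Variables (s : seq I) (y : I -> T -> R) (th : I -> R) (v : R).
Hypothesis us : uniq s.
Hypothesis my : forall i, measurable_fun setT (y i).
Hypothesis v0 : 0 < v.
Hypothesis gf : gaussian_family P s y th v.
Local Notation D := ((size s)%:R : R).

Let mS : measurable_fun setT (fun w => \sum_(i <- s) y i w ^+ 2).
Proof. by apply: measurable_sum => i; exact: measurable_funX. Qed.

Let mQ : measurable_fun setT (fun w => \sum_(i <- s) (y i w ^+ 2 - v)).
Proof.
apply: measurable_sum => i; apply: measurable_funB => //; exact: measurable_funX.
Qed.

Let SE w : \sum_(i <- s) (y i w ^+ 2 - v) = \sum_(i <- s) y i w ^+ 2 - D * v.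
Proof.
rewrite sumrB; congr (_ - _).
by rewrite big_const_seq count_predT iter_addr_0 mulr_natl.
Qed.

Lemma chi2_upper_tail (x lam : R) : 0 < x ->
  (forall i, i \in s -> th i = 0) ->
  v * (2 * Num.sqrt (D * x) + 2 * x) <= lam ->
  (P [set w | (lam <= \sum_(i <- s) (y i w ^+ 2 - v))%R] <= (expR (- x))%:E)%E.
Proof.
move=> x0 th0 lamx.
(* An empty sum is 0 while [lam] is positive, so the event is empty. The t chosen below satisfies 2
   t v < 1 only when D > 0. *)
have [D0|D0] := posnP (size s).
  rewrite (_ : [set w | _] = set0) ?measure0 ?lee_fin ?expR_ge0//.
  apply/seteqP; split => // w /=; rewrite (size0nil D0) big_nil => l0.
  have : 0 < v * (2 * Num.sqrt (D * x) + 2 * x); last by lra.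
  by rewrite mulr_gt0// ltr_wpDl ?mulr_ge0 ?sqrtr_ge0 ?mulr_gt0.
pose p := Num.sqrt D; pose q := Num.sqrt x.
have p0 : 0 < p by rewrite sqrtr_gt0 ltr0n.
have q0 : 0 < q by rewrite sqrtr_gt0.
have p2 : p ^+ 2 = D by rewrite sqr_sqrtr.
have q2 : q ^+ 2 = x by rewrite sqr_sqrtr// ltW.
have pq0 : 0 < p + 2 * q by lra.
(* With w = t v, the exponent - w (2 p q + 2 q^2) + D w^2/(1 - 2 w) is least at w = q/(p + 2 q),
   where it equals - x exactly. *)
pose t := q / (p + 2 * q) / v.
have t0 : 0 < t by rewrite !divr_gt0.
have tv : t * v = q / (p + 2 * q) by rewrite /t divfK// gt_eqF.
have tv1 : 0 < 1 - 2 * (t * v).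
  rewrite tv (_ : 1 - _ = p / (p + 2 * q)); first by rewrite divr_gt0.
  by field; rewrite gt_eqF.
have mE : measurable [set w | lam <= \sum_(i <- s) (y i w ^+ 2 - v)].
  exact: measurable_set_ge.
apply: le_trans (@markov_expR _ (fun w => t * \sum_(i <- s) y i w ^+ 2)
  (t * (lam + D * v)) mE _ _) _.
- exact: measurable_funM.
- by move=> w /=; rewrite SE => h; rewrite ler_pM2l//; lra.
rewrite (family_mgf us my (ltW v0) gf (ltW t0) tv1 th0) -EFinM lee_fin.
apply: (@le_trans _ _ (expR (- (t * (lam + D * v))) *
    expR (t * v + (t * v) ^+ 2 / (1 - 2 * (t * v))) ^+ size s)).
  rewrite ler_pM2l ?expR_gt0// lerXn2r ?nnegrE ?expR_ge0 ?invr_ge0 ?sqrtr_ge0//.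
  have tvw : 0 <= 2 * (t * v) < 1.
    by have := mulr_gt0 t0 v0; move: tv1 => ? ?; apply/andP; split; lra.
  apply: le_trans (invr_sqrt1B_le tvw) _.
  rewrite ler_expR le_eqVlt; apply/orP; left; apply/eqP.
  by field; rewrite gt_eqF.
rewrite -expRM_natl -expRD ler_expR.
have h : t * (v * (2 * (p * q) + 2 * q ^+ 2)) <= t * lam.
  by rewrite ler_pM2l// (le_trans _ lamx)// q2 /p /q -sqrtrM.
suff : t * v * (2 * (p * q) + 2 * q ^+ 2) - D * ((t * v) ^+ 2 / (1 - 2 * (t * v))) = x.
  by move: h; rewrite mulrA; lra.
by rewrite tv -p2 -q2; field; rewrite !gt_eqF//; lra.
Qed.

Lemma chi2_lower_tail (x lam : R) : 0 < x ->
  v * (2 * Num.sqrt (D * x) + 2 * x) <= lam ->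
  4 * lam <= \sum_(i <- s) th i ^+ 2 ->
  (P [set w | (\sum_(i <- s) (y i w ^+ 2 - v) < lam)%R] <= (expR (- x))%:E)%E.
Proof.
move=> x0 lamx Blam.
set B := \sum_(i <- s) _ in Blam.
pose p := Num.sqrt D; pose q := Num.sqrt x.
have p0 : 0 <= p by rewrite sqrtr_ge0.
have q0 : 0 < q by rewrite sqrtr_gt0.
have p2 : p ^+ 2 = D by rewrite sqr_sqrtr.
have q2 : q ^+ 2 = x by rewrite sqr_sqrtr// ltW.
have pq0 : 0 < p + 2 * q by lra.
(* The parameter of the upper tail is kept rather than optimised again. *)
pose t := q / (p + 2 * q) / v.
have t0 : 0 < t by rewrite !divr_gt0.
have tv : t * v = q / (p + 2 * q) by rewrite /t divfK// gt_eqF.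
have tvp : 0 < t * v by rewrite mulr_gt0.
have mE : measurable [set w | (\sum_(i <- s) (y i w ^+ 2 - v) < lam)%R].
  exact: measurable_set_lt.
apply: le_trans (@markov_expR _ (fun w => - t * \sum_(i <- s) y i w ^+ 2)
  (- t * (lam + D * v)) mE _ _) _.
- exact: measurable_funM.
- by move=> w /=; rewrite SE => h; rewrite !mulNr lerN2 ler_pM2l//; lra.
rewrite (family_laplace us my (ltW v0) gf (ltW t0)) -EFinM lee_fin.
have tv1 : 0 < 1 + 2 * (t * v) by lra.
apply: (@le_trans _ _ (expR (t * (lam + D * v)) *
    (expR (- (t * v / (1 + 2 * (t * v)))) ^+ size s *
    expR (- (t * (4 * lam) / (1 + 2 * (t * v))))))).
  rewrite mulNr opprK ler_pM2l ?expR_gt0//.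
  apply: ler_pM; rewrite ?expR_ge0 ?exprn_ge0 ?invr_ge0 ?sqrtr_ge0//.
    rewrite lerXn2r ?nnegrE ?expR_ge0 ?invr_ge0 ?sqrtr_ge0//.
    have tvw : 0 <= 2 * (t * v) by lra.
    apply: le_trans (invr_sqrt1D_le tvw) _.
    rewrite ler_expR le_eqVlt; apply/orP; left; apply/eqP.
    by field; rewrite gt_eqF.
  by rewrite ler_expR !mulNr lerN2 ler_pM2r ?invr_gt0// ler_pM2l.
rewrite -expRM_natl -!expRD ler_expR.
set u := 1 + 2 * (t * v) in tv1 *.
have h : t * (v * (2 * (p * q) + 2 * q ^+ 2)) <= t * lam.
  by rewrite ler_pM2l// (le_trans _ lamx)// q2 /p /q -sqrtrM.
have uE : u = (p + 4 * q) / (p + 2 * q) by rewrite /u tv; field; rewrite gt_eqF.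
(* Multiplied by u, the exponent is t lam (u - 4) + D t v (u - 1). As u < 4 it decreases in [lam],
   which may therefore be replaced by its lower bound. *)
have u4 : u < 4 by rewrite uE ltr_pdivrMr//; lra.
have h2 : t * v * (2 * (p * q) + 2 * q ^+ 2) * (u - 4) >= t * lam * (u - 4).
  by rewrite ler_nM2r ?subr_lt0// -mulrA.
rewrite -(@ler_pM2r _ u)//.
have -> : (t * (lam + D * v) + (D * (- (t * v / u)) + - (t * (4 * lam) / u))) * u =
  t * lam * (u - 4) + D * (t * v) * (u - 1) by field; rewrite gt_eqF.
apply: (@le_trans _ _ (t * v * (2 * (p * q) + 2 * q ^+ 2) * (u - 4) +
    D * (t * v) * (u - 1))).
  by rewrite lerD2r.
(* The slack below vanishes as p / q tends to 0: with this t, no constant smaller than 4 in front of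
   [lam] would do for all D and x. *)
rewrite -subr_ge0.
have -> : - x * u - (t * v * (2 * (p * q) + 2 * q ^+ 2) * (u - 4) + D * (t * v) * (u - 1))
   = q ^+ 2 * (3 * p ^+ 2 + 8 * (p * q)) / (p + 2 * q) ^+ 2.
  by rewrite uE tv -p2 -q2; field; rewrite gt_eqF.
rewrite divr_ge0 ?sqr_ge0// mulr_ge0 ?sqr_ge0// addr_ge0// mulr_ge0 ?sqr_ge0//.
by rewrite mulr_ge0// ltW.
Qed.

End chi_square_tails.

(** * Fourier analysis on the cube *)

Section cube_integrals.
Context {R : realType}.
Local Notation leb01 := (@lebesgue01 R).

Lemma ge0_integral_lebesgue01 (G : measurableTypeR R -> R) :
  measurable_fun setT G -> (forall x, 0 <= G x) ->
  (\int[leb01]_x (G x)%:E =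
   \int[@lebesgue_measure R]_(x in `[0%R, 1%R]) (G x)%:E)%E.
Proof.
move=> mG G0; transitivity (\int[uniform_prob (@ltr01 R)]_x (G x)%:E)%E.
  apply: eq_measure_integral => A mA _.
  rewrite -[RHS]/(\int[lebesgue_measure]_(x in A) (uniform_pdf 0 1 x)%:E)%E.
  rewrite integral_uniform_pdf (eq_integral (cst 1%E)); last first.
    move=> x; rewrite inE/= /uniform_pdf => -[_ /=]; rewrite in_itv/= => ->.
    by rewrite subr0 invr1.
  by rewrite integral_cst ?mul1e//; exact: measurableI.
rewrite integral_uniform//; last exact/measurable_EFinP.
by rewrite subr0 invr1 mul1e.
Qed.

Lemma sin_int_period (c : int) (b : R) : sin (2 * pi * c%:~R + b) = sin b.
Proof.
have H n (a : R) : sin (2 * pi * n%:R + a) = sin a.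
  rewrite -[RHS](periodicn (@sinD2pi R) n a); congr sin.
  rewrite addrC; congr (_ + _).
  by rewrite -mulrA -[RHS]mulr_natr -[in RHS](mulr_natl pi) mulrA.
case: (intP c) => [|n|n]; first by rewrite mulr0 add0r.
  exact: H.
by rewrite -[LHS](H n.+1); congr sin; rewrite mulrNz -pmulrn; ring.
Qed.

Lemma integral01_cos (c : int) (b : R) :
  (\int[leb01]_x (cos (2 * pi * (c%:~R * x) + b))%:E =
   ((c == 0)%:R * cos b)%:E)%E.
Proof.
have [->|c0] := eqVneq c 0.
  rewrite mul1r (eq_integral (cst (cos b)%:E)); last first.
    by move=> x _; rewrite mul0r mulr0 add0r.
  by rewrite integral_cst//= probability_setT mule1.
rewrite mul0r.
have p0 : 2 * pi * c%:~R != 0 :> R.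
  by rewrite !mulf_neq0 ?intr_eq0// gt_eqF// pi_gt0.
set p := 2 * pi * c%:~R in p0 *.
(* Adding 1 makes the integrand nonnegative, as [ge0_integral_lebesgue01] requires. The primitive y
   + sin(p y + b)/p rises by 1 over [0, 1] because p is a multiple of 2 pi. *)
have E1 : (\int[leb01]_x (1 + cos (p * x + b))%:E = 1)%E.
  rewrite ge0_integral_lebesgue01; last 2 first.
  - apply: measurable_funD => //.
    exact: (continuous_measurableT (@continuous_cos_affine R p b)).
  - by move=> x; have := cos_geN1 (p * x + b); lra.
  have dF (x : R) : is_derive x 1 (fun y : R => y + p^-1 * sin (p * y + b))
      (1 + cos (p * x + b)).
    have h := is_deriveD (@is_derive_id R R^o x 1)
      (is_deriveZ p^-1 (is_derive_sin_affine p b x)).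
    apply: (is_derive_eq h); congr (_ + _); rewrite -[LHS]/(_ * _) mulrA mulVf//.
    by rewrite mul1r.
  rewrite (@continuous_FTC2 R (fun x => 1 + cos (p * x + b))
     (fun y : R => y + p^-1 * sin (p * y + b)))//.
  - have -> : sin (p * 1 + b) = sin b by rewrite mulr1; exact: sin_int_period.
    by rewrite mulr0 !add0r -EFinB addrK.
  - apply: continuous_subspaceT => x; apply: cvgD; first exact: cvg_cst.
    exact: continuous_cos_affine.
  - have cF (x : R) : {for x, continuous (fun y : R => y + p^-1 * sin (p * y + b))}.
      apply: differentiable_continuous; apply/derivable1_diffP.
      by have [] := dF x.
    split.
    + by move=> x _; have [] := dF x.
    + exact: cvg_at_right_filter (cF 0).
    + exact: cvg_at_left_filter (cF 1).
  - by move=> x _; rewrite derive1E; exact: (@derive_val _ _ _ _ _ _ _ (dF x)).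
have i1 : leb01.-integrable setT (EFin \o (fun=> 1 : R)).
  exact: finite_measure_integrable_cst.
have ic : leb01.-integrable setT (EFin \o (fun x => cos (p * x + b))).
  apply: (@le_integrable _ _ _ _ _ measurableT _ _ _ _ i1).
    apply/measurable_EFinP.
    exact: (continuous_measurableT (@continuous_cos_affine R p b)).
  by move=> x _ /=; rewrite lee_fin normr1; exact: cos_max.
move: E1; under eq_integral do rewrite EFinD.
rewrite (integralD measurableT i1 ic) integral_cst//= probability_setT mule1 => E1.
have -> : (\int[leb01]_x (cos (2 * pi * (c%:~R * x) + b))%:E =
    \int[leb01]_x (cos (p * x + b))%:E)%E.
  by apply: eq_integral => x _; rewrite mulrA.
have /fineK h := integrable_fin_num measurableT ic.
by move: E1; rewrite -h -EFinD => -[] e; congr EFin; lra.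
Qed.

Lemma integrable_cube_tcons d (F : Rvec R d.+1 -> \bar R) :
  (cube d.+1).-integrable setT F ->
  (leb01 \x cube d)%E.-integrable setT (F \o @tcons R d).
Proof.
move=> /integrableP[mF iF]; apply/integrableP; split.
  exact: (measurableT_comp mF (@measurable_tcons R d)).
move: iF; rewrite /= ge0_integral_distribution//.
exact: measurableT_comp.
Qed.

Lemma integral_cube_recl d (F : Rvec R d.+1 -> \bar R) :
  (cube d.+1).-integrable setT F ->
  (\int[cube d.+1]_x F x = \int[leb01]_a \int[cube d]_x F (tcons (a, x)))%E.
Proof.
move=> iF; have iFt := integrable_cube_tcons iF.
have mF := measurable_int _ iF.
by rewrite /= integral_distribution// -(integral12_prod_meas1 iFt).
Qed.

Lemma integrable_cube_bounded d (F : Rvec R d -> R) (M : R) :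
  measurable_fun setT F -> (forall x, `|F x| <= M) ->
  (cube d).-integrable setT (EFin \o F).
Proof.
move=> mF FM.
have iM : (cube d).-integrable setT (EFin \o (fun=> M)).
  exact: finite_measure_integrable_cst.
apply: (@le_integrable _ _ _ _ _ measurableT _ _ _ _ iM).
  exact/measurable_EFinP.
by move=> x _ /=; rewrite lee_fin (le_trans (FM x))// ler_norm.
Qed.

Lemma measurable_trig_poly d (c : 'I_d -> int) (b : R) :
  measurable_fun setT (fun x : Rvec R d =>
    2 * pi * (\sum_(i < d) (c i)%:~R * (tnth x i : R)) + b).
Proof.
apply: measurable_funD => //; apply: measurable_funM => //.
by apply: measurable_sum => i; apply: measurable_funM => //; exact: measurable_tnth.
Qed.

(** Induction on d: the first coordinate is moved into the phase before the others are integrated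
    out, which is why b is general. *)
Lemma integral_cube_cos d (c : 'I_d -> int) (b : R) :
  (\int[cube d]_x
     (cos (2 * pi * (\sum_(i < d) (c i)%:~R * (tnth x i : R)) + b))%:E =
   ([forall i, c i == 0]%:R * cos b)%:E)%E.
Proof.
elim: d c b => [|d IH] c b.
  rewrite (eq_integral (cst (cos b)%:E)); last first.
    by move=> x _; rewrite big_ord0 mulr0 add0r.
  rewrite integral_cst//= diracT mule1; congr EFin.
  by rewrite (_ : [forall i, _]) ?mul1r//; apply/forallP => -[].
rewrite integral_cube_recl; last first.
  apply: (@integrable_cube_bounded _ (fun x : Rvec R d.+1 =>
    cos (2 * pi * (\sum_(i < d.+1) (c i)%:~R * (tnth x i : R)) + b)) 1).
    apply: (measurableT_comp (continuous_measurableT (@continuous_cos R))).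
    exact: measurable_trig_poly.
  by move=> x; exact: cos_max.
pose c' i := c (lift ord0 i).
transitivity (\int[leb01]_a (([forall i, c' i == 0]%:R)%:E *
    (cos (2 * pi * ((c ord0)%:~R * a) + b))%:E))%E.
  apply: eq_integral => a _; rewrite -EFinM -IH.
  apply: eq_integral => x _; congr (cos _)%:E.
  rewrite big_ord_recl tnth0.
  rewrite (eq_bigr (fun i => (c' i)%:~R * (tnth x i : R))); last first.
    by move=> i _; rewrite tnthS.
  by rewrite /=; ring.
have -> : [forall i, c i == 0] = (c ord0 == 0) && [forall i, c' i == 0].
  apply/forallP/andP => [h|[h0 /forallP h] i].
    by split => //; apply/forallP => i; exact: h.
  by case: (unliftP ord0 i) => [k ->|->//]; exact: h.
rewrite integralZl//.
  by rewrite integral01_cos -EFinM; congr EFin; rewrite mulrA -natrM mulnb andbC.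
apply: (@le_integrable _ _ _ _ _ measurableT _ (EFin \o (fun=> 1 : R))).
- apply/measurable_EFinP.
  have := continuous_measurableT (@continuous_cos_affine R (2 * pi * (c ord0)%:~R) b).
  by under [X in measurable_fun _ X -> _]eq_fun do rewrite -mulrA.
- by move=> x _ /=; rewrite lee_fin normr1; exact: cos_max.
- exact: finite_measure_integrable_cst.
Qed.

Definition upd d (j : 'I_d) (a : measurableTypeR R) (x : Rvec R d) : Rvec R d :=
  [tuple (if i == j then a else tnth x i) | i < d].

Lemma upd_tcons0 d (a b : measurableTypeR R) (x : Rvec R d) :
  upd ord0 b (tcons (a, x)) = tcons (b, x).
Proof.
apply: eq_from_tnth => i; rewrite tnth_mktuple /tcons/=.
by case: (unliftP ord0 i) => [k ->|->]; rewrite ?tnth0// !tnthS.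
Qed.

Lemma upd_tconsS d (j : 'I_d) (a b : measurableTypeR R) (x : Rvec R d) :
  upd (lift ord0 j) b (tcons (a, x)) = tcons (a, upd j b x).
Proof.
apply: eq_from_tnth => i; rewrite tnth_mktuple /tcons/=.
case: (unliftP ord0 i) => [k ->|->]; last by rewrite !tnth0.
by rewrite !tnthS tnth_mktuple (inj_eq (@lift_inj _ _)).
Qed.

Lemma measurable_upd d (j : 'I_d) (x : Rvec R d) :
  measurable_fun setT (fun a : measurableTypeR R => upd j a x).
Proof.
apply/measurable_fun_tnthP => i.
rewrite (_ : _ \o _ = fun a : measurableTypeR R => if i == j then a else tnth x i).
  by case: eqP.
by apply/funext => a; rewrite /= tnth_mktuple.
Qed.

Lemma ae_in_cube d : {ae cube d, forall x : Rvec R d, in_cube x}.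
Proof.
pose B (i : 'I_d) : set (measurableTypeR R) := `[0, 1]%classic.
have E : in_cube = [set x : Rvec R d | forall i, B i (tnth x i)].
  by apply/seteqP; split => x h i; have := h i; rewrite /B /= in_itv.
have mE : measurable (in_cube : set (Rvec R d)).
  rewrite E (_ : [set x | _] = \bigcap_(i in [set: 'I_d])
      ((fun x => tnth x i) @^-1` B i)); last first.
    by apply/seteqP; split => x /= h i; [move=> _|]; exact: h.
  apply: fin_bigcap_measurable; first exact: finite_finset.
  move=> i _; rewrite -[X in measurable X]setTI; apply: measurable_tnth => //.
  exact: measurable_itv.
exists (~` in_cube); split; [exact: measurableC| |by []].
rewrite probability_setC// E cube_box; last by move=> i; exact: measurable_itv.
rewrite big1 ?subee// => i _; rewrite setIid.
by rewrite lebesgue_measure_itv/= lte_fin ltr01 oppr0 adde0.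
Qed.

Lemma ae_lebesgue01 : {ae leb01, forall a : measurableTypeR R, 0 <= (a : R) <= 1}.
Proof.
exists (~` `[0, 1]%classic); split.
- by apply: measurableC; exact: measurable_itv.
- by rewrite /lebesgue01 /mrestr setICl measure0.
- by move=> a h; move=> h'; apply: h; move: h'; rewrite /= in_itv.
Qed.

(** Fubini in coordinate j, by peeling off coordinates until j is the first one. The slices need to
    vanish only for x in the cube, which carries all the mass; sparsity says nothing about f
    elsewhere. *)
Lemma integral_cube_eq0 d (j : 'I_d) (F : Rvec R d -> \bar R) :
  (cube d).-integrable setT F ->
  (forall x, in_cube x -> \int[leb01]_a F (upd j a x) = 0)%E ->
  (\int[cube d]_x F x = 0)%E.
Proof.
elim: d j F => [[]//|d IH] j F iF F0.
have iFt := integrable_cube_tcons iF.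
rewrite integral_cube_recl//.
case: (unliftP ord0 j) F0 => [j' ->|->] F0.
  rewrite (@ae_eq_integral _ _ _ leb01 setT (cst 0%E))//; first by rewrite integral0.
    exact: (measurable_fubini_F iFt).
  have := ae_integrable1 iFt; have := ae_lebesgue01.
  apply: filterS2 => a a01 ia _ /=.
  apply: (IH j'); first exact: ia.
  move=> x xc; rewrite -(F0 (tcons (a, x))).
    by apply: eq_integral => b _; rewrite upd_tconsS.
  move=> i; rewrite /tcons /=.
  by case: (unliftP ord0 i) => [k ->|->]; rewrite ?tnthS ?tnth0.
rewrite (Fubini iFt).
rewrite (@ae_eq_integral _ _ _ (cube d) setT (cst 0%E))//; first by rewrite integral0.
  exact: (measurable_fubini_G iFt).
have := @ae_in_cube d; apply: filterS => x xc _ /=.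
rewrite -(F0 (tcons (0, x))).
  by apply: eq_integral => b _; rewrite upd_tcons0.
move=> i; rewrite /tcons /=.
case: (unliftP ord0 i) => [k ->|->]; rewrite ?tnthS ?tnth0//.
by rewrite lexx ler01.
Qed.

End cube_integrals.

(** * Orthonormality of the basis, and coefficients killed by sparsity *)

Section fourier_basis.
Context {R : realType} {d : nat}.
Implicit Types (k : freq d) (f : Rvec R d -> R) (J : {set 'I_d}).

(** Amplitude and phase that write 1, sqrt 2 cos and sqrt 2 sin as one cosine, so that products of
    basis functions reduce to [integral_cos_phase]. *)
Definition phi_amp k : R := if k == 0 then 1 else Num.sqrt 2.
Definition phi_shift k : R :=
  if (k == 0) || freq_pos k then 0 else - (pi / 2).

Lemma phiE k (x : Rvec R d) :
  phi k x = phi_amp k * cos (phase k x + phi_shift k).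
Proof.
rewrite /phi /phi_amp /phi_shift; have [->|k0] /= := eqVneq k 0.
  rewrite mul1r addr0 /phase big1 ?mulr0 ?cos0// => i _.
  by rewrite ffunE mul0r.
by case: ifP => _; rewrite ?addr0// cosBpihalf.
Qed.

Lemma measurable_cos_phase k (b : R) :
  measurable_fun setT (fun x : Rvec R d => cos (phase k x + b)).
Proof.
apply: (measurableT_comp (continuous_measurableT (@continuous_cos R))).
exact: measurable_trig_poly.
Qed.

Lemma measurable_phi k : measurable_fun setT (@phi R d k).
Proof.
rewrite (_ : phi k = fun x => phi_amp k * cos (phase k x + phi_shift k)); last first.
  by apply/funext => x; exact: phiE.
by apply: measurable_funM => //; exact: measurable_cos_phase.
Qed.

Lemma phi_bounded k (x : Rvec R d) : `|phi k x| <= 2.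
Proof.
rewrite phiE normrM -[leRHS]mulr1 ler_pM//; last exact: cos_max.
rewrite /phi_amp; case: ifP => _; rewrite ger0_norm ?sqrtr_ge0//; first by lra.
by rewrite -ler_sqr ?nnegrE ?sqrtr_ge0// sqr_sqrtr//; lra.
Qed.

Lemma bounded_L2cube (g : Rvec R d -> R) (M : R) :
  measurable_fun setT g -> (forall x, `|g x| <= M) -> g \in L2cube.
Proof.
move=> mg gM; rewrite /L2cube inE; apply/andP; split; rewrite inE/=; first exact: mg.
rewrite /finite_norm unlock /Lnorm poweR_lty//.
apply: (@le_lt_trans _ _ (\int[cube d]_x ((M ^+ 2)%:E))%E); last first.
  by rewrite integral_cst//= probability_setT mule1 ltry.
apply: ge0_le_integral => //=.
- apply/measurable_EFinP.
  apply/(@measurableT_comp _ _ _ _ _ _ (fun x : R => x `^ 2)%R) => //.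
  exact/measurableT_comp.
- move=> x _; rewrite lee_fin powR_mulrn ?normr_ge0//.
  by rewrite lerXn2r ?nnegrE// (le_trans _ (gM x)).
Qed.

Lemma phi_L2cube k : phi k \in @L2cube R d.
Proof. exact: bounded_L2cube (@measurable_phi k) (@phi_bounded k). Qed.

Lemma integrable_L2_phi f k : f \in L2cube ->
  (cube d).-integrable setT (EFin \o (fun x => f x * phi k x)).
Proof.
by move=> fL; apply/Lfun1_integrable; exact: (Lfun2_mul_Lfun1 fL (phi_L2cube k)).
Qed.

(** The signs of k and -k are both decided at their common first nonzero coordinate. So each pair
    has one member on the cosine side and one on the sine side. *)
Lemma freq_posN k : k != 0 -> freq_pos (- k) = ~~ freq_pos k.
Proof.
move=> k0; have [i0 hi0] : exists i, k i != 0.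
  apply/existsP; apply: contraNT k0; rewrite negb_exists => /forallP h.
  by apply/eqP/ffunP => i; have := h i; rewrite negbK => /eqP ->; rewrite ffunE.
case: (@arg_minnP _ i0 (fun i => k i != 0) (@nat_of_ord d) hi0) => i ki imin.
have lt0 (h : freq d) : (forall i', h i' = 0 <-> k i' = 0) ->
    freq_pos h = (0 < h i).
  move=> hk; apply/existsP/idP => [[i1 /andP[h1 /forallP h2]]|hi].
    have k1 : k i1 != 0 by apply/eqP => /hk e; rewrite e ltxx in h1.
    have := imin _ k1; rewrite leq_eqVlt => /orP[/eqP/val_inj -> //|lt].
    by have := h2 i; rewrite lt /= => /eqP/hk e; rewrite e eqxx in ki.
  exists i; rewrite hi/=; apply/forallP => i'; apply/implyP => lt.
  apply/eqP/hk/eqP; apply: contraTT lt => /imin; by rewrite -leqNgt.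
rewrite lt0; last first.
  move=> i'; rewrite ffunE; split => [/eqP|->]; last exact: oppr0.
  by rewrite oppr_eq0 => /eqP.
rewrite (lt0 k)// ffunE oppr_gt0 -leNgt le_eqVlt.
by rewrite (negbTE ki).
Qed.

Lemma integral_cos_phase (c : freq d) (b : R) :
  (\int[cube d]_x (cos (phase c x + b))%:E = ((c == 0)%:R * cos b)%:E)%E.
Proof.
rewrite /phase integral_cube_cos; congr ((_%:R * _)%:E).
by congr nat_of_bool; apply/forallP/eqP => [h|-> i];
  [apply/ffunP => i; rewrite ffunE; apply/eqP; exact: h|rewrite ffunE].
Qed.

Lemma phaseD k k' (x : Rvec R d) : phase (k + k') x = phase k x + phase k' x.
Proof.
rewrite /phase -mulrDr -big_split/=; congr (_ * _).
by apply: eq_bigr => i _; rewrite ffunE intrD mulrDl.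
Qed.

Lemma phaseN k (x : Rvec R d) : phase (- k) x = - phase k x.
Proof.
rewrite /phase -mulrN -sumrN; congr (_ * _).
by apply: eq_bigr => i _; rewrite ffunE mulrNz mulNr.
Qed.

(** By the product-to-sum formula only k = k' and k = -k' contribute. For k nonzero the latter pairs
    a cosine with a sine: the phases add up to - pi/2, whose cosine is 0. For k = k' = 0 both
    contribute, which compensates the smaller amplitude. *)
Lemma phi_orthonormal k k' :
  \int[cube d]_x (phi k x * phi k' x) = (k == k')%:R :> R.
Proof.
have int1 (c : freq d) (b : R) :
    (cube d).-integrable setT (EFin \o (fun x : Rvec R d => cos (phase c x + b))).
  apply: (@integrable_cube_bounded R d _ 1); first exact: measurable_cos_phase.
  by move=> x; exact: cos_max.
have E (x : Rvec R d) : phi k x * phi k' x =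
    phi_amp k * phi_amp k' / 2 * (cos (phase (k - k') x + (phi_shift k - phi_shift k'))
    + cos (phase (k + k') x + (phi_shift k + phi_shift k'))).
  rewrite !phiE !phaseD phaseN.
  set u := phase k x; set v := phase k' x; set a := phi_shift k; set b := phi_shift k'.
  have -> : u - v + (a - b) = (u + a) - (v + b) by ring.
  have -> : u + v + (a + b) = (u + a) + (v + b) by ring.
  by set A := u + a; set B := v + b; rewrite cosB cosD; field.
have -> : \int[cube d]_x (phi k x * phi k' x) = phi_amp k * phi_amp k' / 2 *
    ((k == k')%:R * cos (phi_shift k - phi_shift k') +
     (k == - k')%:R * cos (phi_shift k + phi_shift k')).
  rewrite /Rintegral; under eq_integral do rewrite E EFinM EFinD.
  rewrite integralZl//; last first.
    by apply: integrableD => //; exact: int1.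
  rewrite integralD//; [|exact: int1|exact: int1].
  by rewrite !integral_cos_phase -EFinD -EFinM/= subr_eq0 addr_eq0.
have s2 : Num.sqrt 2 * Num.sqrt 2 = 2 :> R by rewrite -expr2 sqr_sqrtr.
rewrite /phi_amp /phi_shift.
have [->|kk'] := eqVneq k k'.
  rewrite subrr cos0 mulr1; have [->|k0] := eqVneq k' 0.
    by rewrite oppr0 eqxx addr0 cos0; field.
  have -> : (k' == - k') = false.
    apply/negbTE; apply: contra k0 => /eqP/ffunP h; apply/eqP/ffunP => i.
    by move: (h i); rewrite !ffunE => /eqP; rewrite -addr_eq0 -mulr2n mulrn_eq0/= => /eqP.
  by rewrite s2 mul0r addr0 mulr1 divff.
rewrite mul0r add0r; have [kN|_] := eqVneq k (- k'); last by rewrite mul0r mulr0.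
have k'0 : k' != 0.
  by apply: contra kk' => /eqP k'0; rewrite kN k'0 oppr0.
rewrite kN oppr_eq0 (negbTE k'0)/= freq_posN//.
by case: (freq_pos k'); rewrite /= ?addr0 ?add0r ?cosN cos_pihalf !mulr0.
Qed.

(** On the cube f does not depend on x_j, so integrating in x_j alone leaves a cosine over k_j full
    periods. *)
Lemma theta_eq0 dstar kappa L f J k j : f \in L2cube -> C1 dstar kappa L f J ->
  j \notin J -> k j != 0 -> theta f k = 0.
Proof.
move=> fL fC jJ kj.
have [fbar fbarE] := C1_sparse fC.
have iF := integrable_L2_phi k fL.
suff : (\int[cube d]_x (f x * phi k x)%:E = 0)%E by rewrite /theta /Rintegral => ->.
apply: (integral_cube_eq0 (j := j) iF) => x xc.
have mfphi : measurable_fun setT (fun x => f x * phi k x).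
  by have := measurable_int _ iF => /measurable_EFinP.
pose g (a : measurableTypeR R) : R :=
  cos (2 * pi * ((k j)%:~R * (a : R)) +
       (2 * pi * (\sum_(i < d | i != j) (k i)%:~R * (tnth x i : R)) + phi_shift k)).
transitivity (\int[lebesgue01]_a ((f x * phi_amp k)%:E * (g a)%:E))%E.
  apply: ae_eq_integral => //.
  - apply/measurable_EFinP.
    exact: (measurableT_comp mfphi (measurable_upd j x)).
  - apply: emeasurable_funM => //; apply/measurable_EFinP.
    rewrite /g; under eq_fun do rewrite mulrA.
    exact: (continuous_measurableT (@continuous_cos_affine R _ _)).
  have := @ae_lebesgue01 R; apply: filterS => a a01 _ /=.
  rewrite -EFinM; congr EFin; rewrite phiE -mulrA; congr (_ * (_ * cos _)).
    rewrite (fbarE x xc) fbarE; last first.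
      by move=> i; rewrite tnth_mktuple; case: ifP => _; [exact: a01|exact: xc].
    congr fbar; apply: eq_from_tnth => i; rewrite !tnth_mktuple.
    by case: eqP => // e; move: jJ; rewrite -e enum_valP.
  rewrite addrA; congr (_ + _); rewrite /phase (bigD1 j)//= mulrDr.
  rewrite tnth_mktuple eqxx; congr (_ + _ * _).
  by apply: eq_bigr => i /negbTE ij; rewrite tnth_mktuple ij.
rewrite integralZl//; last first.
  apply: (@le_integrable _ _ _ _ _ measurableT _ (EFin \o (fun=> 1 : R))).
  - apply/measurable_EFinP; rewrite /g; under eq_fun do rewrite mulrA.
    exact: (continuous_measurableT (@continuous_cos_affine R _ _)).
  - by move=> a _ /=; rewrite lee_fin normr1; exact: cos_max.
  - exact: finite_measure_integrable_cst.
by rewrite /g integral01_cos (negbTE kj) mul0r mule0.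
Qed.

End fourier_basis.

(** * The white noise coefficients *)

Section white_noise_coefficients.
Context {disp : measure_display} {T : measurableType disp} {R : realType}.
Variable P : probability T R.

(** The unknown location m of [gaussian] equals the known mean, since X - m has mean 0 by
    [gaussian_mean0]. *)
Lemma gaussian_repr_mean (X : T -> R) (mu : R) :
  measurable_fun setT X -> gaussian P X -> (\int[P]_w (X w)%:E = mu%:E)%E ->
  exists2 s, 0 <= s & gaussian_repr P X mu s.
Proof.
move=> mX /(gaussian_reprP mX)[m [s [s0 Xms]]] Xmu; exists s => //.
suff -> : mu = m by [].
have Xm := gaussian_repr_shift m Xms; rewrite subrr in Xm.
have mXm : measurable_fun setT (fun w => X w - m) by exact: measurable_funB.
have iXm := gaussian_integrable mXm Xm.
have i1 : P.-integrable setT (EFin \o (fun=> m)).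
  exact: finite_measure_integrable_cst.
have := gaussian_mean0 mXm Xm; rewrite /Rintegral => h.
have := integrable_fin_num measurableT iXm => /fineK; rewrite h => /esym h0.
have : (\int[P]_w ((X w - m)%:E + m%:E) = m%:E)%E.
  rewrite (integralD measurableT iXm i1) [X in (X + _)%E]h0 add0e.
  by rewrite integral_cst//= probability_setT mule1.
under eq_integral do rewrite -EFinD subrK.
by rewrite Xmu => -[].
Qed.

Context {d n : nat}.
Variables (f : Rvec R d -> R) (Y : (Rvec R d -> R) -> {RV P >-> R}).
Hypothesis fL : f \in L2cube.
Hypothesis wY : white_noise n f Y.

Let Yk (k : freq d) : T -> R := Y (phi k).
Let mY k : measurable_fun setT (Yk k). Proof. exact: measurable_funPT. Qed.

Let gaussian_lin (s : seq (freq d)) (c : freq d -> R) :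
  gaussian P (fun w => \sum_(k <- s) c k * Yk k w).
Proof.
have := wn_gaussian wY (p := size s) (g := fun i => phi (nth 0 s i))
  (fun i => c (nth 0 s i)) (fun i => phi_L2cube _).
by under eq_fun do rewrite
  -(big_mkord xpredT (fun i => c (nth 0 s i) * Y (phi (nth 0 s i)) _))
  -(big_nth 0 xpredT (fun k => c k * Yk k _)).
Qed.

Let Ymean k : (\int[P]_w (Yk k w)%:E = (theta f k)%:E)%E.
Proof. by have := wn_mean wY (phi_L2cube k); rewrite unlock. Qed.

Let Yrepr k : exists2 s, 0 <= s & gaussian_repr P (fun w => Yk k w - theta f k) 0 s.
Proof.
have gY : gaussian P (Yk k).
  have := gaussian_lin [:: k] (fun=> 1).
  by under eq_fun do rewrite big_seq1 mul1r.
have [s s0 sE] := gaussian_repr_mean (mY k) gY (Ymean k).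
by exists s => //; have := gaussian_repr_shift (theta f k) sE; rewrite subrr.
Qed.

Let mYc k : measurable_fun setT (fun w => Yk k w - theta f k).
Proof. exact: measurable_funB. Qed.

Let iY2 k : P.-integrable setT (EFin \o (fun w => (Yk k w - theta f k) ^+ 2)).
Proof. by have [s s0 /(gaussian_integrable_sqr (mYc k))] := Yrepr k. Qed.

Let iY k : P.-integrable setT (EFin \o Yk k).
Proof.
have [s s0 /(gaussian_integrable (mYc k)) h] := Yrepr k.
have i1 : P.-integrable setT (EFin \o (fun=> theta f k)).
  exact: finite_measure_integrable_cst.
have := integrableD measurableT h i1; apply: eq_integrable => // w _ /=.
by rewrite -EFinD subrK.
Qed.

Let iYY k k' : P.-integrable setT
  (EFin \o (fun w => (Yk k w - theta f k) * (Yk k' w - theta f k'))).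
Proof.
have := integrableD measurableT (iY2 k) (iY2 k').
apply: le_integrable => //.
  by apply/measurable_EFinP; exact: measurable_funM.
move=> w _ /=; rewrite lee_fin [leRHS]ger0_norm ?addr_ge0 ?sqr_ge0//.
move: (Yk k w - _) (Yk k' w - _) => a b.
have h1 := sqr_ge0 (a + b); have h2 := sqr_ge0 (a - b).
rewrite sqrrD in h1; rewrite sqrrB in h2.
have := sqr_ge0 a; have := sqr_ge0 b.
by rewrite ler_norml; move=> h3 h4; apply/andP; split; lra.
Qed.

Let Ycov k k' : (\int[P]_w ((Yk k w - theta f k) * (Yk k' w - theta f k'))%:E =
  (n%:R^-1 * (k == k')%:R)%:E)%E.
Proof.
have := wn_cov wY (phi_L2cube k) (phi_L2cube k').
rewrite phi_orthonormal => <-; rewrite unlock.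
rewrite (wn_mean wY (phi_L2cube k)) (wn_mean wY (phi_L2cube k')).
by rewrite unlock.
Qed.

(** The location of a combination is fixed by [wn_mean]; its scale by comparing [gaussian_mean_sqr]
    with the second moment computed from [wn_cov] and orthonormality. *)
Lemma white_noise_family (s : seq (freq d)) : uniq s ->
  gaussian_family P s (fun k w => Y (phi k) w) (theta f) n%:R^-1.
Proof.
move=> us c; pose X w := \sum_(k <- s) c k * Yk k w.
have mX : measurable_fun setT X.
  by apply: measurable_sum => k; exact: measurable_funM.
have icY k : P.-integrable setT (fun w => (c k * Yk k w)%:E).
  by under eq_fun do rewrite EFinM; apply: integrableZl => //; exact: iY.
have EX : (\int[P]_w (X w)%:E = (\sum_(k <- s) c k * theta f k)%:E)%E.
  rewrite /X; under eq_integral do rewrite -sumEFin.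
  rewrite integral_sum// -sumEFin; apply: eq_bigr => k _.
  under eq_integral do rewrite EFinM.
  by rewrite integralZl//; [rewrite Ymean|exact: iY].
have [t t0 Xt] := gaussian_repr_mean mX (gaussian_lin s c) EX.
suff -> : Num.sqrt (n%:R^-1 * \sum_(i <- s) c i ^+ 2) = t by [].
rewrite -[RHS]ger0_norm// -sqrtr_sqr; congr Num.sqrt.
set mu := \sum_(k <- s) _ in EX Xt.
have mXm : measurable_fun setT (fun w => X w - mu) by exact: measurable_funB.
have Xt0 := gaussian_repr_shift mu Xt; rewrite subrr in Xt0.
rewrite -(gaussian_mean_sqr mXm Xt0).
have icc k k' : P.-integrable setT
    (fun w => ((c k * c k') * ((Yk k w - theta f k) * (Yk k' w - theta f k')))%:E).
  by under eq_fun do rewrite EFinM; apply: integrableZl => //; exact: iYY.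
have -> : \int[P]_w (X w - mu) ^+ 2 = fine (\int[P]_w
    \sum_(k <- s) \sum_(k' <- s)
     ((c k * c k') * ((Yk k w - theta f k) * (Yk k' w - theta f k')))%:E)%E.
  rewrite /Rintegral; congr fine; apply: eq_integral => w _.
  rewrite /X /mu -sumrB expr2 mulr_suml -sumEFin; apply: eq_bigr => k _.
  rewrite mulr_sumr -sumEFin; apply: eq_bigr => k' _; congr EFin; ring.
rewrite integral_sum//; last first.
  by move=> k; apply: integrable_sum => // k' _; exact: icc.
rewrite (eq_big_seq (fun k => (n%:R^-1 * c k ^+ 2)%:E)).
  by rewrite sumEFin/= mulr_sumr.
move=> k ks; rewrite [LHS](_ : _ = \sum_(k' <- s)
    (c k * c k' * (n%:R^-1 * (k == k')%:R))%:E)%E; last first.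
  rewrite integral_sum//; apply: eq_bigr => k' _.
  under eq_integral do rewrite EFinM.
  by rewrite integralZl//; [rewrite Ycov|exact: iYY].
rewrite sumEFin; congr EFin; rewrite (bigD1_seq k)//= eqxx big1 => [|k' /negbTE k'k].
  by rewrite [LHS]addr0 mulr1 mulrC expr2.
by rewrite eq_sym k'k !mulr0.
Qed.

End white_noise_coefficients.

(** * Frequency sets and signal strength *)

Section frequency_sets.
Context {R : realType}.

Lemma sqnorm2_ge0 d (k : freq d) : 0 <= sqnorm2 k :> R.
Proof. by apply: sumr_ge0 => i _; exact: sqr_ge0. Qed.

(** Integer coordinates satisfy |k_i| <= k_i^2 <= N with N above r; shifted by N, such k are
    functions into {0, ..., 2N}. *)
Lemma finite_sqnorm2_le d (r : R) : finite_set [set k : freq d | sqnorm2 k <= r].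
Proof.
pose N := Num.bound r.
pose h (g : {ffun 'I_d -> 'I_(N + N).+1}) : freq d :=
  [ffun i => (g i : nat)%:Z - N%:Z].
apply: (@sub_finite_set _ _ (range h)); last exact: finite_image.
move=> k /= kr.
have kN i : (`|k i| <= N)%N.
  have h1 : (`|k i|%N)%:R ^+ 2 <= N%:R :> R.
    apply: (@le_trans _ _ r); last first.
      by apply/ltW/archi_boundP; exact: le_trans (sqnorm2_ge0 k) kr.
    apply: le_trans kr; rewrite /sqnorm2 (bigD1 i)//=.
    rewrite -[X in X <= _]addr0 lerD//; last by apply: sumr_ge0 => ? _; exact: sqr_ge0.
    by rewrite natr_absz intr_norm real_normK ?num_real.
  rewrite -(ler_nat R); apply: le_trans h1; rewrite -natrX ler_nat.
  by case: (`|k i|)%N => // q; rewrite expnS leq_pmulr ?expn_gt0.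
have kb i : (`|(k i + N%:Z)%R| < (N + N).+1)%N.
  by rewrite ltnS -lez_nat abszE (le_trans (ler_normD _ _))// PoszD lerD2r lez_nat.
have k0 i : 0 <= k i + N%:Z.
  rewrite -lerBlDr sub0r lerNl; apply: (@le_trans _ _ (`|k i|%:Z)).
    by rewrite abszE -normrN; exact: ler_norm.
  exact: kN.
exists [ffun i => Ordinal (kb i)] => //; apply/ffunP => i.
by rewrite !ffunE/= gez0_abs// addrK.
Qed.

Lemma finite_S d (m : R) (I : {set 'I_d}) j : finite_set (S_ m I j).
Proof.
apply: sub_finite_set (@finite_sqnorm2_le d (m ^+ 2)) => k [km _ _] /=.
have n0 : 0 <= norm2 k :> R by exact: sqrtr_ge0.
rewrite -(sqr_sqrtr (sqnorm2_ge0 k)) -/(norm2 k).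
by rewrite lerXn2r// nnegrE// (le_trans n0).
Qed.

Lemma card_S_le d (m : R) (I : {set 'I_d}) j : 0 <= m -> j \in I ->
  (#|` fset_set (S_ m I j)| <= Ncard #|I| (m ^+ 2 / #|I|%:R))%N.
Proof.
move=> m0 jI.
have l0 : (0 < #|I|)%N by apply/card_gt0P; exists j.
pose z := Ordinal l0.
(* An enumeration of I in which a transposition puts j at position 0, because [Ncard] asks for a
   nonzero first coordinate. *)
pose e (i : 'I_#|I|) : 'I_d := enum_val (tperm z (enum_rank_in jI j) i).
have einj : injective e by move=> a b /enum_val_inj/perm_inj.
have ez : e z = j by rewrite /e tpermL enum_rankK_in.
have eI i : e i \in I by exact: enum_valP.
have eS i : i \in I -> exists a, e a = i.
  move=> iI; exists (tperm z (enum_rank_in jI j) (enum_rank_in jI i)).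
  by rewrite /e tpermK enum_rankK_in.
pose Phi (k : freq d) : freq #|I| := [ffun a => k (e a)].
have out k i : S_ m I j k -> i \notin I -> k i = 0.
  move=> [_ _ /fintype.subsetP kI] iI; apply/eqP; apply: contraNT iI => ki.
  by apply: kI; rewrite inE.
have Phi_norm k : S_ m I j k -> sqnorm2 (Phi k) = sqnorm2 k :> R.
  move=> kS; rewrite /sqnorm2 [RHS](bigID (mem I))/= [X in _ + X]big1 ?addr0; last first.
    by move=> i iI; rewrite (out k)// expr0n.
  rewrite (eq_bigr (fun a => (k (e a))%:~R ^+ 2)); last by move=> a _; rewrite ffunE.
  rewrite -(big_map e xpredT (fun i => (k i)%:~R ^+ 2)) -[RHS]big_enum/=.
  apply: perm_big; apply: uniq_perm.
  - by rewrite map_inj_uniq// index_enum_uniq.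
  - exact: enum_uniq.
  move=> i; rewrite mem_enum; apply/mapP/idP => [[a _ ->]|/eS[a <-]]; first exact: eI.
  by exists a; rewrite ?mem_index_enum.
have Phi_inj : {in fset_set (S_ m I j) &, injective Phi}.
  move=> k k'; rewrite !in_fset_set; [|exact: finite_S|exact: finite_S].
  rewrite !inE => kS k'S /ffunP kk'; apply/ffunP => i.
  have [/eS[a <-]|iI] := boolP (i \in I); first by have := kk' a; rewrite !ffunE.
  by rewrite !out.
have -> : #|` fset_set (S_ m I j)| = #|` (Phi @` fset_set (S_ m I j))%fset|.
  by rewrite card_in_imfset.
apply: fsubset_leq_card; apply/fsubsetP => h /imfsetP[k /=].
rewrite in_fset_set ?inE; last exact: finite_S.
move=> kS ->; rewrite in_fset_set ?inE.
  split; last first.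
    exists z; split=> //; rewrite ffunE ez.
    by have [_ + _] := kS; rewrite inE.
  rewrite (Phi_norm _ kS) divfK ?pnatr_eq0 -?lt0n//.
  rewrite -(sqr_sqrtr (sqnorm2_ge0 k)) -/(norm2 k).
  have n0 : 0 <= norm2 k :> R by exact: sqrtr_ge0.
  by have [kn _ _] := kS; rewrite lerXn2r// nnegrE.
by apply: sub_finite_set (@finite_sqnorm2_le #|I| (m ^+ 2 / #|I|%:R * #|I|%:R)) => ? [].
Qed.

End frequency_sets.

Lemma esumZ_le {R : realType} {I : choiceType} (A : set I) (c : R) (b : I -> R) :
  0 <= c ->
  (\esum_(i in A) (c * b i)%:E <= c%:E * \esum_(i in A) (b i)%:E)%E.
Proof.
move=> c0; apply: ge_ereal_sup => _ [F [fF FA] <-].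
rewrite fsbig_finite//= sumEFin -mulr_sumr EFinM.
rewrite lee_wpmul2l ?lee_fin//; apply: esum_ge; exists F => //.
by rewrite fsbig_finite// sumEFin.
Qed.

(** * Lower bound on the captured signal *)

Section signal_strength.
Context {R : realType} {d : nat}.
Variables (dstar : nat) (kappa L tau : R) (f : Rvec R d -> R) (J : {set 'I_d}).
Hypothesis k0 : 0 < kappa.
Hypothesis t0 : 0 < tau.
Hypothesis fL : f \in L2cube.
Hypothesis fC : C1 dstar kappa L f J.

(** A nonzero integer k_j has k_j^2 >= 1, so Q_j is below the smoothness sum. This gives L > 0,
    hence a positive radius m_s by which one can divide. *)
Lemma L_ge_kappa j : j \in J -> kappa <= L.
Proof.
move=> jJ; rewrite -lee_fin; apply: le_trans (C1_relevant fC jJ) _.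
apply: le_trans (C1_smooth fC j); rewrite /Qj esum_mkcond.
apply: le_esum => k _; case: ifPn => [|_]; last first.
  by rewrite lee_fin mulr_ge0 ?sqr_ge0.
rewrite inE/= => kj; rewrite lee_fin ler_peMl ?sqr_ge0//.
have : 1 <= (k j) ^+ 2 by rewrite -gtz0_ge1 exprn_even_gt0.
by rewrite -(ler_int R) rmorphXn.
Qed.

Lemma signal_ge j : j \in J ->
  kappa * tau / (1 + tau) <=
  \sum_(k <- fset_set (S_ (m_ kappa L tau #|J|) J j)) theta f k ^+ 2.
Proof.
move=> jJ; have LK := L_ge_kappa jJ; have L0 : 0 < L by exact: lt_le_trans LK.
have t1 : 0 < 1 + tau by rewrite addr_gt0.
set m := m_ _ _ _ _; set S := S_ m J j.
have J0 : (0 < #|J|)%N by apply/card_gt0P; exists j.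
have J0R : 0 < #|J|%:R :> R by rewrite ltr0n.
have m2 : m ^+ 2 = #|J|%:R * L * (1 + tau) / kappa.
  by rewrite sqr_sqrtr// divr_ge0 ?mulr_ge0 ?(ltW t1) ?(ltW L0) ?(ltW k0).
have m20 : 0 < m ^+ 2.
  by rewrite m2 divr_gt0// mulr_gt0 ?mulr_gt0.
have m0 : 0 <= m by exact: sqrtr_ge0.
pose a (k : freq d) : R := theta f k ^+ 2.
pose b (k : freq d) i : R := (k i)%:~R ^+ 2 * theta f k ^+ 2.
have a0 k : 0 <= a k by exact: sqr_ge0.
have b0 k i : 0 <= b k i by rewrite mulr_ge0 ?sqr_ge0.
have fS := finite_S m J j : finite_set S.
(* A termwise Markov bound. A frequency with k_j <> 0 outside S either leaves J, and then theta is
   0, or has norm above m, and then 1 is at most m^(-2) times the sum of k_i^2 over i in J. *)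
have bound : (Qj f j <= \esum_(k in [set: freq d])
    ((if k \in S then (a k)%:E else 0) + \sum_(i in J) ((m ^+ 2)^-1 * b k i)%:E))%E.
  rewrite /Qj esum_mkcond; apply: le_esum => k _.
  have s0 : (0 <= \sum_(i in J) ((m ^+ 2)^-1 * b k i)%:E)%E.
    by apply: sume_ge0 => i _; rewrite lee_fin mulr_ge0// invr_ge0 ltW.
  case: ifPn => [|_]; last by rewrite adde_ge0//; case: ifP; rewrite ?lee_fin.
  rewrite inE/= => kj; case: ifPn => [_|kS]; first by rewrite leeDl.
  rewrite add0e sumEFin -mulr_sumr lee_fin.
  have [kJ|] := boolP (supp k \subset J); last first.
    move=> /fintype.subsetPn[i]; rewrite inE => ki iJ.
    rewrite (theta_eq0 fL fC iJ ki) expr0n/= mulr_ge0//.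
      by rewrite invr_ge0 ltW.
    by apply: sumr_ge0 => i' _.
  rewrite ler_pdivlMl// /b -mulr_suml ler_wpM2r ?sqr_ge0//.
  have -> : \sum_(i in J) (k i)%:~R ^+ 2 = sqnorm2 k :> R.
    rewrite /sqnorm2 [RHS](bigID (mem J))/= [X in _ + X]big1 ?addr0// => i iJ.
    suff -> : k i = 0 by rewrite expr0n.
    apply/eqP; apply: contraNT iJ => ki.
    by have /fintype.subsetP := kJ; apply; rewrite inE.
  rewrite leNgt; apply: contra kS => km; rewrite inE; split=> //; last by rewrite inE.
  by rewrite /norm2 -[leRHS]ger0_norm// -sqrtr_sqr ler_sqrt ?sqr_ge0// ltW.
have := le_trans (C1_relevant fC jJ) bound.
rewrite esumD; last 2 first.
- by move=> k _; case: ifP => _; rewrite ?lee_fin.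
- by move=> k _; apply: sume_ge0 => i _; rewrite lee_fin mulr_ge0// invr_ge0 ltW.
rewrite -(esum_mkcond S (fun k => (a k)%:E)) esum_fset//; last first.
  by move=> k _; rewrite lee_fin.
rewrite fsbig_finite// sumEFin.
rewrite esum_sum; last first.
  by move=> k i _ _; rewrite lee_fin mulr_ge0// invr_ge0 ltW.
have tail : (\sum_(i in J) \esum_(k in [set: freq d]) ((m ^+ 2)^-1 * b k i)%:E
    <= (kappa / (1 + tau))%:E)%E.
  apply: (@le_trans _ _ (\sum_(i in J) ((m ^+ 2)^-1 * L)%:E)%E).
    apply: lee_sum => i _.
    apply: (@le_trans _ _ (((m ^+ 2)^-1)%:E * L%:E)%E); last by rewrite EFinM.
    apply: (@le_trans _ _ (((m ^+ 2)^-1)%:E * \esum_(k in [set: freq d]) (b k i)%:E)%E).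
      by apply: esumZ_le; rewrite invr_ge0 ltW.
    by rewrite lee_wpmul2l ?lee_fin ?invr_ge0 ?(ltW m20)//; exact: (C1_smooth fC).
  rewrite sumEFin lee_fin sumr_const -mulr_natl m2 le_eqVlt; apply/orP; left.
  by apply/eqP; field; rewrite !gt_eqF.
move=> h; have {h} := le_trans h (leeD2l _ tail); rewrite -EFinD lee_fin => h.
have e : kappa * tau / (1 + tau) = kappa - kappa / (1 + tau).
  by field; rewrite gt_eqF.
by rewrite e; lra.
Qed.

End signal_strength.

(** * Counting and error probabilities *)

Section counting.
Context {R : realType}.

(** With q = m/d <= 1, q^m <= q^l for l <= m, so q^m times the sum is at most (1 + q)^d <= exp(q d)
    = exp(m). *)
Lemma sum_binomial_le (d m : nat) : (1 <= m <= d)%N ->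
  (\sum_(l < m.+1) 'C(d, l))%:R <= (expR 1 * d%:R / m%:R) ^+ m :> R.
Proof.
move=> /andP[m0 md].
have m0R : 0 < m%:R :> R by rewrite ltr0n.
have d0R : 0 < d%:R :> R by rewrite ltr0n (leq_trans m0).
pose q : R := m%:R / d%:R.
have q0 : 0 < q by rewrite divr_gt0.
have q1 : q <= 1 by rewrite ler_pdivrMr// mul1r ler_nat.
have key : q ^+ m * (\sum_(l < m.+1) 'C(d, l))%:R <= expR 1 ^+ m.
  apply: (@le_trans _ _ ((1 + q) ^+ d)); last first.
    rewrite -expRM_natl mulr1; apply: (@le_trans _ _ (expR q ^+ d)).
      by rewrite lerXn2r ?nnegrE ?expR_ge0 ?expR_ge1Dx// addr_ge0// ltW.
    by rewrite -expRM_natl ler_expR /q mulrCA divff ?mulr1// gt_eqF.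
  rewrite exprDn natr_sum mulr_sumr.
  rewrite -(big_mkord xpredT (fun l => q ^+ m * 'C(d, l)%:R)).
  rewrite -(big_mkord xpredT (fun l => 1 ^+ (d - l) * q ^+ l *+ 'C(d, l))).
  rewrite [leRHS](@big_cat_nat _ _ _ m.+1)//=.
  rewrite -[leLHS]addr0 lerD//; last first.
    by apply: sumr_ge0 => l _; rewrite expr1n mul1r mulrn_wge0// exprn_ge0// ltW.
  apply: ler_sum_nat => l /andP[_ lm]; rewrite expr1n mul1r -[leRHS]mulr_natr.
  rewrite ler_wpM2r// -(subnK (lm : (l <= m)%N)) exprD ler_piMl ?exprn_ge0 ?(ltW q0)//.
  by rewrite exprn_ile1// ltW.
rewrite -ler_pdivlMl ?exprn_gt0// in key; apply: (le_trans key).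
rewrite -exprVn -exprMn le_eqVlt; apply/orP; left; apply/eqP; congr (_ ^+ _).
by rewrite /q invf_div mulrC mulrA.
Qed.

Lemma ratio_gt1 (d dstar : nat) : (1 <= dstar <= d)%N -> 1 < Defs.ratio d dstar :> R.
Proof.
move=> /andP[s0 sd]; rewrite /Defs.ratio -mulrA.
have s0R : 0 < dstar%:R :> R by rewrite ltr0n.
have h1 : 1 <= d%:R / dstar%:R :> R by rewrite ler_pdivlMr// mul1r ler_nat.
have := expR_ge1Dx (1 : R); nra.
Qed.

(** The factor 2 of [ratio] absorbs the choice of j in I, through dstar <= 2^dstar. *)
Lemma ratio_expn (d dstar : nat) : (1 <= dstar <= d)%N ->
  (dstar * \sum_(l < dstar.+1) 'C(d, l))%:R <= (Defs.ratio d dstar : R) ^+ dstar.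
Proof.
move=> h; rewrite natrM.
have -> : Defs.ratio d dstar = 2 * (expR 1 * d%:R / dstar%:R) :> R.
  by rewrite /Defs.ratio !mulrA.
rewrite exprMn ler_pM//; last exact: sum_binomial_le.
by rewrite -natrX ler_nat ltnW// ltn_expl.
Qed.

Lemma card_small_sets (d m : nat) :
  (\sum_(I : {set 'I_d} | (#|I| <= m)%N) 1 = \sum_(l < m.+1) 'C(d, l))%N.
Proof.
rewrite (partition_big (fun I : {set 'I_d} => inord #|I| : 'I_m.+1) xpredT)//=.
apply: eq_bigr => l _; rewrite -[in RHS](card_ord d) -card_draws sum1_card.
apply: eq_card => I; rewrite !inE unfold_in.
apply/andP/eqP => [[Im /eqP <-]|Il]; first by rewrite inordK.
have Im : (#|I| <= m)%N by rewrite Il -ltnS.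
by split=> //; apply/eqP/val_inj; rewrite /= inordK.
Qed.

End counting.

Section union_bound.
Context {disp : measure_display} {T : measurableType disp} {R : realType}.
Variable P : probability T R.

Lemma union_bound (I : eqType) (s : seq I) (p : pred I) (A : I -> set T)
    (E : set T) : measurable E -> (forall i, measurable (A i)) ->
  (forall w, E w -> exists2 i, (i \in s) && p i & A i w) ->
  (P E <= \sum_(i <- s | p i) P (A i))%E.
Proof.
move=> mE mA EA.
have mU (r : seq I) : measurable (\big[setU/set0]_(i <- r | p i) A i).
  by apply: bigsetU_measurable => i _; exact: mA.
apply: (@le_trans _ _ (P (\big[setU/set0]_(i <- s | p i) A i))).
  apply: le_measure; rewrite ?inE//.
  move=> w /EA[i /andP[si pi] Aiw].
  elim: s si {EA} => // a s IH; rewrite inE big_cons => /orP[/eqP <-|/IH h].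
    by rewrite pi; left.
  by case: ifP => _ //; right.
elim: s {EA} => [|a s IH]; first by rewrite !big_nil measure0.
rewrite !big_cons; case: ifP => // _.
by apply: le_trans (measureU2 P (mA a) (mU s)) _; rewrite leeD2l.
Qed.

Lemma ge_bigmaxe (I : eqType) (s : seq I) (p : pred I) (F : I -> \bar R) (a : R) :
  (a%:E <= \big[maxe/-oo]_(i <- s | p i) F i)%E =
  has (fun i => p i && (a%:E <= F i)%E) s.
Proof.
elim: s => [|b s IH]; first by rewrite big_nil /= leNgt ltNyr.
by rewrite big_cons /=; case: (p b) => //=; rewrite le_max IH.
Qed.

End union_bound.

(** * The rate and its limit *)

Section rate.
Context {R : realType}.
Implicit Types A : R.

Lemma rateE A (d dstar : nat) : (1 <= dstar <= d)%N ->
  rate A d dstar = Defs.ratio d dstar ^+ dstar *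
                   expR (- (A * dstar%:R * ln (Defs.ratio d dstar))).
Proof.
move=> h; have r0 : 0 < Defs.ratio d dstar :> R := lt_trans ltr01 (ratio_gt1 h).
rewrite /rate /powR gt_eqF// -[X in X ^+ _](lnK r0) -expRM_natl -expRD.
by congr expR; ring.
Qed.

(** Here c is the number of events in a union bound, each of probability at most [ratio] to the
    power - A dstar. *)
Lemma rate_ge (A c : R) (d dstar : nat) : (1 <= dstar <= d)%N ->
  c <= (dstar * \sum_(l < dstar.+1) 'C(d, l))%:R ->
  c * expR (- (A * dstar%:R * ln (Defs.ratio d dstar))) <= rate A d dstar.
Proof.
move=> h hc; rewrite rateE// ler_wpM2r ?expR_ge0//.
exact: le_trans hc (ratio_expn h).
Qed.

Lemma rate_ge0 A (d dstar : nat) : 0 <= rate A d dstar.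
Proof. exact: powR_ge0. Qed.

(** The term l = 1 of the binomial sum is d, so [ratio] to the power dstar is at least d. The bound
    is free of dstar, which may vary with d. *)
Lemma rate_le A (d dstar : nat) : 1 < A -> (1 <= dstar <= d)%N ->
  rate A d dstar <= (d%:R `^ (A - 1))^-1.
Proof.
move=> A1 h; have r0 : 0 < Defs.ratio d dstar :> R := lt_trans ltr01 (ratio_gt1 h).
rewrite /rate powRN powRrM powR_mulrn ?(ltW r0)//.
have /andP[s0 sd] := h; have d0 : (0 < d)%N := leq_trans s0 sd.
rewrite lef_pV2 ?posrE ?powR_gt0 ?exprn_gt0 ?ltr0n//.
apply: ge0_ler_powR; rewrite ?nnegrE ?subr_ge0 ?exprn_ge0 ?(ltW A1) ?(ltW r0)//.
apply: le_trans (ratio_expn h); rewrite ler_nat.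
rewrite -(bin1 d) -[X in (X <= _)%N]mul1n leq_mul// bin1.
by rewrite (bigD1 (inord 1))//= inordK ?ltnS// bin1 leq_addr.
Qed.

Lemma cvg_rate (A : R) (d dstar : nat -> nat) : 1 < A ->
  (forall t, (1 <= dstar t <= d t)%N) -> d t @[t --> \oo] --> \oo ->
  rate A (d t) (dstar t) @[t --> \oo] --> (0 : R).
Proof.
move=> A1 h /cvgnyPge dy; apply/cvgr0Pnorm_le => e e0.
have c0 : 0 < A - 1 by rewrite subr_gt0.
(* This N makes N^(A - 1) >= 1/e, with e the tolerance. *)
have [N HN] : exists N : nat, e `^ (- (A - 1)^-1) <= N%:R.
  by exists (Num.bound (e `^ (- (A - 1)^-1))); rewrite ltW// archi_boundP// powR_ge0.
near=> t; rewrite ger0_norm ?rate_ge0//; apply: le_trans (rate_le A1 (h t)) _.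
have dN : (N <= d t)%N by near: t; exact: dy.
rewrite -[leRHS]invrK lef_pV2 ?posrE ?invr_gt0//; last first.
  by rewrite powR_gt0// ltr0n; have /andP[s0] := h t; exact: leq_trans.
have -> : e^-1 = (e `^ (- (A - 1)^-1)) `^ (A - 1).
  by rewrite -powRrM mulNr mulVf ?gt_eqF// powRN powRr1// ltW.
apply: ge0_ler_powR; rewrite ?nnegrE ?powR_ge0 ?(ltW c0)//.
by apply: le_trans HN _; rewrite ler_nat.
Unshelve. all: by end_near. Qed.

End rate.

Section random_finite_set.
Context {disp : measure_display} {T : measurableType disp}.

Lemma measurable_random_set (I : finType) (F : T -> {set I}) (p : pred {set I}) :
  (forall j, measurable [set w | j \in F w]) -> measurable [set w | p (F w)].
Proof.
move=> mF.
rewrite (_ : [set w | p (F w)] = \bigcup_(B in [set` p])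
    \bigcap_(j in [set: I]) [set w | (j \in F w) = (j \in B)]); last first.
  apply/seteqP; split => [w pw|w [B pB h]] /=; first by exists (F w).
  by rewrite (_ : F w = B)//; apply/setP => j; exact: h.
apply: fin_bigcup_measurable; first exact: finite_finset.
move=> B _; apply: fin_bigcap_measurable; first exact: finite_finset.
move=> j _; case: (j \in B).
  by rewrite (_ : [set w | _] = [set w | j \in F w])//; exact: mF.
rewrite (_ : [set w | _] = ~` [set w | j \in F w]); first exact/measurableC/mF.
by apply/seteqP; split => w /=; case: (j \in F w).
Qed.

End random_finite_set.

Section estimator.
Context {disp : measure_display} {T : measurableType disp} {R : realType}.
Context {P : probability T R} {d : nat}.
Variables (dstar n : nat) (Y : (Rvec R d -> R) -> {RV P >-> R}).

Lemma QhatE (m : R) (I : {set 'I_d}) j w :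
  Qhat n Y m I j w =
  \sum_(k <- fset_set (S_ m I j)) (Y (phi k) w ^+ 2 - n%:R^-1).
Proof. exact: fsbig_finite (finite_S m I j). Qed.

Lemma Qhat_notin (m : R) (I : {set 'I_d}) j w : j \notin I ->
  Qhat n Y m I j w = 0.
Proof.
move=> jI; rewrite /Qhat (_ : S_ m I j = set0) ?fsbig_set0//.
apply/seteqP; split => // k [_ jk /fintype.subsetP/(_ _ jk)].
by rewrite (negbTE jI).
Qed.

Lemma measurable_Qhat (m : R) (I : {set 'I_d}) j :
  measurable_fun setT (Qhat n Y m I j).
Proof.
rewrite (_ : Qhat n Y m I j = fun w => \sum_(k <- fset_set (S_ m I j))
    (Y (phi k) w ^+ 2 - n%:R^-1)); last by apply/funext => w; exact: QhatE.
by apply: measurable_sum => k; apply: measurable_funB => //; exact: measurable_funX.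
Qed.

(** A maximum reaches a real number exactly when one of its terms does, and the neutral element -oo
    never does; levels l > d, where no I exists, are therefore harmless. *)
Lemma in_Jhat (m lambda : nat -> R) w j : (forall l, 0 < lambda l) ->
  (j \in Jhat dstar n Y m lambda w) =
  [exists I : {set 'I_d}, (1 <= #|I| <= dstar)%N &&
                          (lambda #|I| <= Qhat n Y (m #|I|) I j w)].
Proof.
move=> l0; rewrite inE ge_bigmaxe; apply/hasP/existsP.
  move=> [l]; rewrite mem_index_iota ltnS => hl /=.
  rewrite lee_pdivlMl// mule1 ge_bigmaxe => /hasP[I _ /andP[/eqP Il]].
  by rewrite lee_fin -Il in hl * => ?; exists I; rewrite hl.
move=> [I /andP[hI hQ]]; exists #|I|; rewrite ?mem_index_iota//=.
rewrite lee_pdivlMl// mule1 ge_bigmaxe; apply/hasP; exists I.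
  exact: mem_index_enum.
by rewrite eqxx lee_fin.
Qed.

Lemma measurable_Jhat (m lambda : nat -> R) (p : pred {set 'I_d}) :
  (forall l, 0 < lambda l) ->
  measurable [set w | p (Jhat dstar n Y m lambda w)].
Proof.
move=> l0; apply: measurable_random_set => j.
rewrite (_ : [set w | _] = \bigcup_(I in [set I : {set 'I_d} | (1 <= #|I| <= dstar)%N])
    [set w | lambda #|I| <= Qhat n Y (m #|I|) I j w]); last first.
  apply/seteqP; split => w /=; rewrite in_Jhat//.
    by move=> /existsP[I /andP[? ?]]; exists I.
  by move=> [I /= hI hQ]; apply/existsP; exists I; rewrite hI.
apply: fin_bigcup_measurable; first exact: finite_finset.
by move=> I _; apply: measurable_set_ge; exact: measurable_Qhat.
Qed.

End estimator.

(** * Error probabilities of the estimator *)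

Section error_probabilities.
Context {disp : measure_display} {T : measurableType disp} {R : realType}.
Context {P : probability T R} {d dstar n : nat} {A kappa L tau : R}.
Context {f : Rvec R d -> R} {J : {set 'I_d}}.
Context {Y : (Rvec R d -> R) -> {RV P >-> R}}.
Hypothesis A1 : 1 < A.
Hypothesis adm : admissible A dstar n kappa L tau f J Y.

Let m := m_ kappa L tau.
Let lam := lambda_ A d dstar n kappa L tau.
Let x := A * dstar%:R * ln (Defs.ratio d dstar).

Let hd : (1 <= dstar <= d)%N. Proof. exact: adm_dstar adm. Qed.

Let x0 : 0 < x.
Proof.
have /andP[s0 _] := hd.
by rewrite /x !mulr_gt0 ?ltr0n ?ln_gt0 ?ratio_gt1// (lt_trans ltr01).
Qed.

Let v0 : 0 < n%:R^-1 :> R.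
Proof. by rewrite invr_gt0 ltr0n (adm_n adm). Qed.

Lemma lambda_E l : lam l = n%:R^-1 *
  (2 * Num.sqrt ((Ncard l (m l ^+ 2 / l%:R))%:R * x) + 2 * x).
Proof.
rewrite /lam /lambda_ /x mulrC; congr (_ * _); congr (2 * Num.sqrt _ + _); ring.
Qed.

Lemma lambda__gt0 l : 0 < lam l.
Proof.
rewrite lambda_E mulr_gt0// ltr_wpDl ?mulr_ge0 ?sqrtr_ge0//.
by rewrite mulr_gt0.
Qed.

(** [card_S_le] bounds the number of summands uniformly over j and over I of a given size, so one
    threshold per level is enough. *)
Lemma chi2_threshold_le (I : {set 'I_d}) j : j \in I ->
  n%:R^-1 * (2 * Num.sqrt
    ((size (fset_set (S_ (m #|I|) I j)))%:R * x) + 2 * x) <= lam #|I|.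
Proof.
move=> jI; rewrite lambda_E ler_wpM2l ?(ltW v0)// lerD2r ler_wpM2l//.
apply: ler_wsqrtr; rewrite ler_wpM2r ?(ltW x0)// ler_nat.
by apply: card_S_le => //; exact: sqrtr_ge0.
Qed.

Lemma false_positive_le (I : {set 'I_d}) j : j \in I -> j \notin J ->
  (P [set w | (lam #|I| <= Qhat n Y (m #|I|) I j w)%R] <= (expR (- x))%:E)%E.
Proof.
move=> jI jJ; under eq_set do rewrite QhatE.
have us := fset_uniq (fset_set (S_ (m #|I|) I j)).
apply: (chi2_upper_tail us _ v0 (white_noise_family (adm_Y adm) us) x0) => //.
  move=> k; rewrite in_fset_set ?inE => [[_ jk _]|]; last exact: finite_S.
  apply: (theta_eq0 (adm_f adm) (adm_C1 adm) jJ).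
  by move: jk; rewrite inE.
exact: chi2_threshold_le.
Qed.

Lemma false_negative_le j : j \in J ->
  (P [set w | (Qhat n Y (m #|J|) J j w < lam #|J|)%R] <= (expR (- x))%:E)%E.
Proof.
move=> jJ; under eq_set do rewrite QhatE.
have us := fset_uniq (fset_set (S_ (m #|J|) J j)).
apply: (chi2_lower_tail us _ v0 (white_noise_family (adm_Y adm) us) x0) => //.
  exact: chi2_threshold_le.
apply: le_trans (adm_cond adm) _.
exact: signal_ge (adm_kappa adm) (adm_tau adm) (adm_f adm) (adm_C1 adm) _ jJ.
Qed.

Let Jh := Jhat dstar n Y m lam.

Let mJh (p : pred {set 'I_d}) : measurable [set w | p (Jh w)].
Proof. exact: measurable_Jhat lambda__gt0. Qed.

(** The union runs over j in J with I = J fixed: at most dstar events, already covered by the term l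
    = 0 of the binomial sum. *)
Lemma prob_missing_le : (P [set w | ~~ (J \subset Jh w)] <= (rate A d dstar)%:E)%E.
Proof.
have bad w : ~~ (J \subset Jh w) -> exists2 j, (j \in index_enum 'I_d) && (j \in J) &
    Qhat n Y (m #|J|) J j w < lam #|J|.
  move=> /subsetPn[j jJ]; rewrite in_Jhat ?negb_exists//; last exact: lambda__gt0.
  move=> /forallP/(_ J); rewrite (adm_s adm) (C1_card (adm_C1 adm)) /= -ltNge.
  by exists j => //; rewrite mem_index_enum.
have mB j : measurable [set w | Qhat n Y (m #|J|) J j w < lam #|J|].
  by apply: measurable_set_lt; exact: measurable_Qhat.
apply: le_trans (union_bound P (mJh (fun B => ~~ (J \subset B))) mB bad) _.
apply: (@le_trans _ _ (\sum_(j in J) (expR (- x))%:E)%E).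
  by apply: lee_sum => j jJ; exact: false_negative_le.
rewrite sumEFin lee_fin sumr_const -mulr_natl; apply: rate_ge => //.
rewrite ler_nat (leq_trans (C1_card (adm_C1 adm)))// -[X in (X <= _)%N]muln1 leq_mul//.
by rewrite (bigD1 ord0)//= bin0.
Qed.

Lemma prob_excess_le : (P [set w | ~~ (Jh w \subset J)] <= (rate A d dstar)%:E)%E.
Proof.
pose p (a : {set 'I_d} * 'I_d) :=
  (#|a.1| <= dstar)%N && ((a.2 \in a.1) && (a.2 \notin J)).
have bad w : ~~ (Jh w \subset J) -> exists2 a, (a \in index_enum _) && p a &
    lam #|a.1| <= Qhat n Y (m #|a.1|) a.1 a.2 w.
  move=> /subsetPn[j]; rewrite in_Jhat; last exact: lambda__gt0.
  move=> /existsP[I /andP[/andP[_ Is] hQ]] jJ; exists (I, j) => //=.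
  (* For j outside I the statistic is 0, below the positive threshold; hence a set I that selects j
     contains it. *)
  rewrite mem_index_enum /p /= Is jJ andbT; apply: contraLR hQ => jI.
  by rewrite Qhat_notin// -ltNge; exact: lambda__gt0.
have mB (a : {set 'I_d} * 'I_d) :
    measurable [set w | lam #|a.1| <= Qhat n Y (m #|a.1|) a.1 a.2 w].
  by apply: measurable_set_ge; exact: measurable_Qhat.
apply: le_trans (union_bound P (mJh (fun B => ~~ (B \subset J))) mB bad) _.
apply: (@le_trans _ _ (\sum_(a | p a) (expR (- x))%:E)%E).
  by apply: lee_sum => a /andP[_ /andP[jI jJ]]; exact: false_positive_le.
rewrite sumEFin lee_fin sumr_const -mulr_natl; apply: rate_ge => //.
(* Each I of size at most dstar contributes at most dstar indices j. *)
rewrite ler_nat -sum1_card -card_small_sets big_distrr /=.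
under [leqRHS]eq_bigr do rewrite muln1.
rewrite -(pair_big_dep (fun I : {set 'I_d} => (#|I| <= dstar)%N)
  (fun I j => (j \in I) && (j \notin J)) (fun _ _ => 1%N)) /=.
apply: leq_sum => I Is; apply: leq_trans Is; rewrite sum1_card.
by apply: subset_leq_card; apply/fintype.subsetP => j; rewrite unfold_in => /andP[].
Qed.

Lemma prob_neq_le : (P [set w | Jh w != J] <= (2 * rate A d dstar)%:E)%E.
Proof.
apply: (@le_trans _ _ (P ([set w | ~~ (J \subset Jh w)] `|`
                          [set w | ~~ (Jh w \subset J)]))).
  apply: le_measure; rewrite ?inE//; first exact: (mJh (fun B => B != J)).
    apply: measurableU; first exact: (mJh (fun B => ~~ (J \subset B))).
    exact: (mJh (fun B => ~~ (B \subset J))).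
  move=> w /=; rewrite finset.eqEsubset negb_and => /orP[|]; [by right|by left].
apply: le_trans (measureU2 P (mJh (fun B => ~~ (J \subset B)))
                             (mJh (fun B => ~~ (B \subset J)))) _.
by rewrite mulr_natl mulr2n EFinD leeD ?prob_missing_le ?prob_excess_le.
Qed.

End error_probabilities.

Theorem theorem1 (R : realType) (A : R) (hA : 1 < A) :
  (* the two probability bounds *)
  (forall (disp : measure_display) (T : measurableType disp)
      (P : probability T R) (d dstar n : nat) (kappa L tau : R)
      (f : Rvec R d -> R) (J : {set 'I_d})
      (Y : (Rvec R d -> R) -> {RV P >-> R}),
    admissible A dstar n kappa L tau f J Y ->
    let Jh := Jhat dstar n Y (m_ kappa L tau)
                (lambda_ A d dstar n kappa L tau) in
    (P [set w | ~~ (J \subset Jh w)] <= (2 * rate A d dstar)%:E)%E /\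
    (P [set w | Jh w != J] <= (3 * rate A d dstar)%:E)%E) /\
  (* consistency: A is fixed, everything else may vary as d -> oo *)
  (forall (disp : nat -> measure_display)
      (T : forall t, measurableType (disp t))
      (P : forall t, probability (T t) R) (d dstar n : nat -> nat)
      (kappa L tau : nat -> R) (f : forall t, Rvec R (d t) -> R)
      (J : forall t, {set 'I_(d t)})
      (Y : forall t, (Rvec R (d t) -> R) -> {RV P t >-> R}),
    (forall t, admissible A (dstar t) (n t) (kappa t) (L t) (tau t)
                 (f t) (J t) (Y t)) ->
    d t @[t --> \oo] --> \oo ->
    P t [set w | Jhat (dstar t) (n t) (Y t) (m_ (kappa t) (L t) (tau t))
                   (lambda_ A (d t) (dstar t) (n t) (kappa t) (L t) (tau t)) w
                 != J t] @[t --> \oo] --> 0%E).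
Proof.
split.
  move=> disp T P d dstar n kappa L tau f J Y adm Jh.
  have r0 := rate_ge0 A d dstar; split.
    (* The factors obtained are 1 and 2; since the rate is nonnegative they relax to 2 and 3. *)
    by apply: le_trans (prob_missing_le hA adm) _; rewrite lee_fin ler_peMl// ler1n.
  by apply: le_trans (prob_neq_le hA adm) _; rewrite lee_fin ler_wpM2r// ler_nat.
move=> disp T P d dstar n kappa L tau f J Y adm dy.
apply: (@squeeze_cvge _ _ _ _ (cst 0%E) _
  (fun t => (2 * rate A (d t) (dstar t))%:E)).
- by near=> t; rewrite measure_ge0; exact: prob_neq_le hA (adm t).
- exact: cvg_cst.
apply: cvg_EFin; first exact: nearW.
rewrite -[X in _ --> X](mulr0 (2 : R)); apply: cvgMr.
by apply: cvg_rate => // t; exact: adm_dstar (adm t).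
Unshelve. all: by end_near. Qed.
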